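(* Let $(M^n,g)$, $n\ge3$, be Einstein with $\mathrm{Ric}(g)=\lambda(n-1)g$ and let $\widehat g=e^{2\omega}g$, $\omega\in C^\infty(M)$, be a conformally related Einstein metric with $\mathrm{Ric}(\widehat g)=\widehat\lambda(n-1)\widehat g$ ($\lambda,\widehat\lambda$ constants). Suppose $\Sigma^k\subset M$, $1\le k\le n-1$, is a submanifold which is minimal relative to both $g$ and $\widehat g$. Let $h$, $\widehat h$ denote the metrics induced on $\Sigma$ by $g$, $\widehat g$, and define, for $\ell\ge1$, $$P_{2\ell}=\prod_{j=1}^{\ell}(-\Delta_h+\lambda c_j),\qquad \widehat P_{2\ell}=\prod_{j=1}^{\ell}(-\Delta_{\widehat h}+\widehat\lambda c_j),\qquad c_j=\big(\tfrac k2+j-1\big)\big(\tfrac k2-j\big).$$ Then for all $\ell\ge1$, $$\widehat P_{2\ell}=e^{(-k/2-\ell)\,\omega|_\Sigma}\circ P_{2\ell}\circ e^{(k/2-\ell)\,\omega|_\Sigma}.$$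
   Context: Laplacians have the sign $\Delta=\sum\partial_i^2$ on Euclidean space. $e^{a\omega|_\Sigma}$ denotes the operator of multiplication by that function on $C^\infty(\Sigma)$. Submanifolds are embedded; minimal means the mean curvature vector vanishes. *)

(* Defs.v *)
From HB Require Import structures.
From mathcomp Require Import all_boot all_order all_algebra.
From mathcomp Require Import all_classical all_reals all_analysis.
Set Implicit Arguments.
Unset Strict Implicit.
Unset Printing Implicit Defensive.
Import Order.TTheory GRing.Theory Num.Theory numFieldNormedType.Exports.
Local Open Scope classical_set_scope.
Local Open Scope ring_scope.

(** ** Calculus on open subsets of R^n

    Points and vectors of R^n are row vectors, so that the Jacobian matrix of
    [f] has the partial derivative of [f^j] along [x^i] in row [i], column
    [j]. *)

Definition partial (R : realType) (n : nat) (i : 'I_n) (f : 'rV[R]_n -> R) :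
    'rV[R]_n -> R :=
  fun x => 'D_(delta_mx 0 i) f x.

Definition jac (R : realType) (m n : nat) (f : 'rV[R]_m -> 'rV[R]_n)
    (x : 'rV[R]_m) : 'M[R]_(m, n) :=
  \matrix_(i, j) partial i (fun y => f y 0 j) x.

(* C^oo on an open set [U]: the iterated partial derivatives of all orders
   (indexed by the list of successive directions) are differentiable on [U]. *)
Definition smooth_on (R : realType) (n : nat) (U : set 'rV[R]_n)
    (f : 'rV[R]_n -> R) : Prop :=
  forall (s : seq 'I_n) (x : 'rV[R]_n), U x ->
    differentiable (foldr (@partial R n) f s) x.

Definition vsmooth_on (R : realType) (m n : nat) (U : set 'rV[R]_m)
    (f : 'rV[R]_m -> 'rV[R]_n) : Prop :=
  forall j : 'I_n, smooth_on U (fun x => f x 0 j).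

(** ** Smooth manifolds *)

(* [coord] and [param] are mutually inverse homeomorphisms between the open
   sets [dom] and [cod]; their values outside these sets are irrelevant. *)
Record chart (R : realType) (T : topologicalType) (n : nat) := Chart {
  dom : set T ;
  cod : set 'rV[R]_n ;
  coord : T -> 'rV[R]_n ;
  param : 'rV[R]_n -> T ;
  dom_open : open dom ;
  cod_open : open cod ;
  coord_cod : forall p, dom p -> cod (coord p) ;
  param_dom : forall x, cod x -> dom (param x) ;
  coordK : forall p, dom p -> param (coord p) = p ;
  paramK : forall x, cod x -> coord (param x) = x ;
  coord_continuous : forall p, dom p -> {for p, continuous coord} ;
  param_continuous : forall x, cod x -> {for x, continuous param}
}.

(* The atlas need not be maximal.  [chart_at p] is a chosen chart around [p];
   it is used only to give total definitions of objects that do not depend on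
   the chart. *)
Record manifold (R : realType) (n : nat) := Manifold {
  point_of :> topologicalType ;
  atlas : set (chart R point_of n) ;
  chart_at : point_of -> chart R point_of n ;
  manifold_hausdorff : hausdorff_space point_of ;
  manifold_second_countable : @second_countable point_of ;
  chart_at_atlas : forall p, atlas (chart_at p) ;
  dom_chart_at : forall p, dom (chart_at p) p ;
  transition_smooth : forall c c', atlas c -> atlas c' ->
    vsmooth_on (cod c `&` (param c @^-1` dom c')) (coord c' \o param c)
}.

Arguments atlas {R n} _.

Definition smooth_fun (R : realType) (n : nat) (M : manifold R n)
    (u : M -> R) : Prop :=
  forall c, atlas M c -> smooth_on (cod c) (u \o param c).

(** ** Riemannian metrics *)

(* [components c x] is the matrix g_ij(x) of the metric in the chart [c]. *)
Record metric (R : realType) (n : nat) (M : manifold R n) := Metric {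
  components : chart R M n -> 'rV[R]_n -> 'M[R]_n ;
  metric_smooth : forall c, atlas M c -> forall i j,
    smooth_on (cod c) (fun x => components c x i j) ;
  metric_sym : forall c, atlas M c -> forall x, cod c x ->
    (components c x)^T = components c x ;
  metric_pos : forall c, atlas M c -> forall x, cod c x ->
    forall v : 'rV[R]_n, v != 0 -> 0 < (v *m components c x *m v^T) 0 0 ;
  metric_change : forall c c', atlas M c -> atlas M c' ->
    forall p, dom c p -> dom c' p ->
    let J := jac (coord c' \o param c) (coord c p) in
    components c (coord c p) = J *m components c' (coord c' p) *m J^T
}.

(* The local expressions below are given for the components [G] of a metric
   on an open subset of R^n. *)

(* Gamma^m_ij = 1/2 g^ml (d_i g_jl + d_j g_il - d_l g_ij) *)
Definition christoffel (R : realType) (n : nat) (G : 'rV[R]_n -> 'M[R]_n)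
    (m i j : 'I_n) (x : 'rV[R]_n) : R :=
  2^-1 * \sum_(l < n) invmx (G x) m l *
    (partial i (fun y => G y j l) x + partial j (fun y => G y i l) x
     - partial l (fun y => G y i j) x).

(* R^r_{s i j} = dx^r (R(d_i, d_j) d_s), where
   R(X, Y) = [nabla_X, nabla_Y] - nabla_[X, Y] *)
Definition riemann (R : realType) (n : nat) (G : 'rV[R]_n -> 'M[R]_n)
    (r s i j : 'I_n) (x : 'rV[R]_n) : R :=
  partial i (christoffel G r j s) x - partial j (christoffel G r i s) x
  + \sum_(l < n) (christoffel G r i l x * christoffel G l j s x
                  - christoffel G r j l x * christoffel G l i s x).

(* The sign is such that round spheres have positive Ricci curvature. *)
Definition ricci (R : realType) (n : nat) (G : 'rV[R]_n -> 'M[R]_n)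
    (i j : 'I_n) (x : 'rV[R]_n) : R :=
  \sum_(r < n) riemann G r i r j x.

(* Ric(g) = lam (n - 1) g *)
Definition einstein (R : realType) (n : nat) (M : manifold R n)
    (g : metric M) (lam : R) : Prop :=
  forall c, atlas M c -> forall x, cod c x -> forall i j,
    ricci (components g c) i j x = lam * (n%:R - 1) * components g c x i j.

(* ghat = e^(2 omega) g *)
Definition conformal (R : realType) (n : nat) (M : manifold R n)
    (omega : M -> R) (g ghat : metric M) : Prop :=
  forall c, atlas M c -> forall x, cod c x ->
    components ghat c x = expR (2 * omega (param c x)) *: components g c x.

(* Delta u = g^ij (nabla^2 u)_ij, the trace of the covariant Hessian *)
Definition local_laplacian (R : realType) (n : nat) (G : 'rV[R]_n -> 'M[R]_n)
    (u : 'rV[R]_n -> R) (x : 'rV[R]_n) : R :=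
  \sum_(i < n) \sum_(j < n) invmx (G x) i j *
    (partial i (partial j u) x
     - \sum_(m < n) christoffel G m i j x * partial m u x).

Definition laplacian (R : realType) (n : nat) (M : manifold R n)
    (g : metric M) (u : M -> R) : M -> R :=
  fun p => let c := chart_at p in
    local_laplacian (components g c) (u \o param c) (coord c p).

(** ** Embedded submanifolds

    A k-dimensional submanifold of [M] is a k-manifold [S] together with a
    smooth embedding [iota : S -> M], the inclusion. *)

Section Submanifolds.
Context (R : realType) (k n : nat) (S : manifold R k) (M : manifold R n).
Implicit Types (iota : S -> M) (d : chart R S k) (c : chart R M n).

Definition local_map iota d c : 'rV[R]_k -> 'rV[R]_n :=
  coord c \o iota \o param d.

Definition local_dom iota d c : set 'rV[R]_k :=
  cod d `&` ((iota \o param d) @^-1` dom c).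

Definition smooth_embedding iota : Prop :=
  [/\ continuous iota,
      forall d c, atlas S d -> atlas M c ->
        vsmooth_on (local_dom iota d c) (local_map iota d c),
      forall d c, atlas S d -> atlas M c -> forall y, local_dom iota d c y ->
        row_free (jac (local_map iota d c) y),
      injective iota
    & forall O : set S, open O ->
        exists2 W : set M, open W & iota @` O = range iota `&` W].

End Submanifolds.

(* In this group [G] are the components of the ambient metric and [F] is the
   local expression of the inclusion. *)

(* h_ab = g_ij d_a F^i d_b F^j *)
Definition local_induced (R : realType) (k n : nat) (G : 'rV[R]_n -> 'M[R]_n)
    (F : 'rV[R]_k -> 'rV[R]_n) (y : 'rV[R]_k) : 'M[R]_k :=
  jac F y *m G (F y) *m (jac F y)^T.

Definition induced_metric (R : realType) (k n : nat) (S : manifold R k)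
    (M : manifold R n) (iota : S -> M) (g : metric M) (h : metric S) : Prop :=
  forall d c, atlas S d -> atlas M c -> forall y, local_dom iota d c y ->
    components h d y
    = local_induced (components g c) (local_map iota d c) y.

(* v - h^ab g(v, d_a F) d_b F *)
Definition normal_part (R : realType) (k n : nat) (G : 'rV[R]_n -> 'M[R]_n)
    (F : 'rV[R]_k -> 'rV[R]_n) (y : 'rV[R]_k) (v : 'rV[R]_n) : 'rV[R]_n :=
  v - v *m G (F y) *m (jac F y)^T *m invmx (local_induced G F y) *m jac F y.

(* ambient covariant derivative, along F, of d_b F in the direction d_a *)
Definition ambient_nabla (R : realType) (k n : nat) (G : 'rV[R]_n -> 'M[R]_n)
    (F : 'rV[R]_k -> 'rV[R]_n) (a b : 'I_k) (y : 'rV[R]_k) : 'rV[R]_n :=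
  \row_(i < n) (partial a (partial b (fun z => F z 0 i)) y
    + \sum_(j < n) \sum_(l < n) christoffel G i j l (F y)
        * jac F y a j * jac F y b l).

Definition second_fundamental_form (R : realType) (k n : nat)
    (G : 'rV[R]_n -> 'M[R]_n) (F : 'rV[R]_k -> 'rV[R]_n) (a b : 'I_k)
    (y : 'rV[R]_k) : 'rV[R]_n :=
  normal_part G F y (ambient_nabla G F a b y).

(* the trace of the second fundamental form, not divided by k *)
Definition mean_curvature (R : realType) (k n : nat)
    (G : 'rV[R]_n -> 'M[R]_n) (F : 'rV[R]_k -> 'rV[R]_n)
    (y : 'rV[R]_k) : 'rV[R]_n :=
  \sum_(a < k) \sum_(b < k)
    invmx (local_induced G F y) a b *: second_fundamental_form G F a b y.

Definition minimal (R : realType) (k n : nat) (S : manifold R k)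
    (M : manifold R n) (iota : S -> M) (g : metric M) : Prop :=
  forall d c, atlas S d -> atlas M c -> forall y, local_dom iota d c y ->
    mean_curvature (components g c) (local_map iota d c) y = 0.

(** ** The operators P_2l *)

Definition cj (R : realType) (k j : nat) : R :=
  (k%:R / 2 + j%:R - 1) * (k%:R / 2 - j%:R).

Definition factor (R : realType) (k : nat) (S : manifold R k) (h : metric S)
    (lam : R) (j : nat) (u : S -> R) : S -> R :=
  fun p => - laplacian h u p + lam * cj R k j * u p.

Definition P2 (R : realType) (k : nat) (S : manifold R k) (h : metric S)
    (lam : R) (l : nat) : (S -> R) -> (S -> R) :=
  \big[(fun A B => A \o B)/(fun u => u)]_(1 <= j < l.+1) factor h lam j.

Definition multiplication (R : realType) (T : Type) (f u : T -> R) : T -> R :=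
  fun p => f p * u p.

(* Main.v *)
(** Put [s = exp (- omega)].  Comparing the two Einstein equations through the
    conformal change of the Ricci tensor shows that the Hessian of [s] is a
    multiple [f g] of the metric, with
    [2 s f = |ds|^2 - lambda s^2 + lambdahat].  Minimality for both metrics
    forces the gradient of [omega] to be tangent to the submanifold, so by the
    Gauss formula [s] restricted to it satisfies the same equation
    [Hess s = f h], and [df = - lambda ds].

    On the submanifold, with [k] its dimension, let [Z = [Delta, s]],
    [F_j = - Delta + lambda c_j] and [Q_l = s F_(l+1) + l (Z - (2 l + 2) f)].
    The vector field [grad s] is conformal, which gives the commutators
    [[Delta, f] = - lambda Z] and
    [[Delta, Z] = 4 f Delta - 2 lambda Z - lambda k (k - 2) f], and these amount
    to [F_l Q_l = Q_(l-1) F_(l+1)].  Hence [P_l Q_l = s P_l F_(l+1)] by induction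
    on [l].  Since [s^(l - k/2)] intertwines the [l+1]-st factor of the second
    metric with [Q_l s^(l + 1 - k/2)], a second induction on [l] gives the
    covariance of the products. *)

Require Import Defs.
From HB Require Import structures.
From mathcomp Require Import all_boot all_order all_algebra.
From mathcomp Require Import all_classical all_reals all_analysis.
From mathcomp Require Import ring lra.
Import Order.TTheory GRing.Theory Num.Theory numFieldNormedType.Exports.
Local Open Scope classical_set_scope.
Local Open Scope ring_scope.
Set Implicit Arguments.
Unset Strict Implicit.
Unset Printing Implicit Defensive.

(** * Riemannian identities in a commutative ring with derivations *)

(** The operators have arbitrary order, so the computations live in a commutative ring with
    commuting derivations, where they become polynomial identities; values at points enter only when
    these identities are carried back to charts.

    The function s is preferred to omega because Hess omega - d omega d omega = - Hess(s) / s: the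
    trace-free part of the change of the Ricci tensor is linear in s.

    The Einstein condition does not pass to the submanifold, so nothing is known about the curvature
    of h. What does pass is Hess s = f h with the relation 2 s f = |ds|^2 - lambda s^2 + lambdahat.
    Differentiating that relation gives df = - lambda ds, and the commutators come from Lie
    differentiating the coefficients of Delta along grad s; the curvature of h never appears.

    The constants are c_j = k (k - 2) / 4 - j (j - 1). In F_l Q_l - Q_(l-1) F_(l+1) the terms in Z
    cancel because c_l - c_(l+1) = 2 l, those in f because 4 c_l = k (k - 2) - 4 l (l - 1). *)

Section Derivations.
Context (A : comPzRingType) (n : nat) (D : 'I_n -> A -> A).

(** The ring may be trivial, since smooth functions on an empty open set form the zero ring. There
    is no field of constants: a constant is an element killed by every derivation, and one half is
    an element [half] with [half + half = 1]. *)
Definition commuting_derivations : Prop :=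
  [/\ forall i a b, D i (a + b) = D i a + D i b,
      forall i a b, D i (a * b) = D i a * b + a * D i b
    & forall i j a, D i (D j a) = D j (D i a)].

Hypothesis Dder : commuting_derivations.

Let DD i a b : D i (a + b) = D i a + D i b. Proof. by case: Dder. Qed.
Let DM i a b : D i (a * b) = D i a * b + a * D i b. Proof. by case: Dder. Qed.
Let DC i j a : D i (D j a) = D j (D i a). Proof. by case: Dder. Qed.

Lemma der0 i : D i 0 = 0.
Proof. by apply: (addrI (D i 0)); rewrite -DD !addr0. Qed.

Lemma derN i a : D i (- a) = - D i a.
Proof. by apply: (addrI (D i a)); rewrite -DD !subrr der0. Qed.

Lemma derB i a b : D i (a - b) = D i a - D i b.
Proof. by rewrite DD derN. Qed.

Lemma der1 i : D i 1 = 0.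
Proof.
by apply: (addrI (D i 1)); rewrite addr0 -[in RHS](mulr1 1) DM mul1r mulr1.
Qed.

Lemma der_sum (I : Type) (r : seq I) (P : pred I) i (F : I -> A) :
  D i (\sum_(j <- r | P j) F j) = \sum_(j <- r | P j) D i (F j).
Proof. exact: (big_morph (D i) (DD i) (der0 i)). Qed.

Lemma der_nat i (b : nat) : D i b%:R = 0.
Proof.
by elim: b => [|b IHb]; rewrite ?der0 // -addn1 natrD DD IHb der1 addr0.
Qed.

Definition dmx p q (i : 'I_n) (X : 'M[A]_(p, q)) := map_mx (D i) X.

Lemma dmxM p q r i (X : 'M[A]_(p, q)) (Y : 'M[A]_(q, r)) :
  dmx i (X *m Y) = dmx i X *m Y + X *m dmx i Y.
Proof.
apply/matrixP=> a b; rewrite !mxE der_sum -big_split /=.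
by apply: eq_bigr => c _; rewrite DM !mxE.
Qed.

Lemma dmx1 p i : dmx i (1%:M : 'M[A]_p) = 0.
Proof. by apply/matrixP=> a b; rewrite !mxE der_nat. Qed.

Lemma der_mxtrace p i (X : 'M[A]_p) : D i (\tr X) = \tr (dmx i X).
Proof. by rewrite der_sum; apply: eq_bigr => a _; rewrite mxE. Qed.

Context (half : A).
Hypothesis halfE : half + half = 1.

Lemma der_half i : D i half = 0.
Proof.
have E : D i half + D i half = 0 by rewrite -DD halfE der1.
by rewrite -[LHS]mul1r -halfE mulrDl -mulrDr E mulr0.
Qed.

Lemma half_mulD a : half * a + half * a = a.
Proof. by rewrite -mulrDl halfE mul1r. Qed.

(** Christoffel symbols of the first kind, lowered index first; [chr] raises that index with the
    inverse metric [Gi]. *)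
Definition chrL (G : 'M[A]_n) (l i j : 'I_n) :=
  half * (D i (G j l) + D j (G i l) - D l (G i j)).

Definition chr (G Gi : 'M[A]_n) (m i j : 'I_n) :=
  \sum_l Gi m l * chrL G l i j.

Context (G Gi : 'M[A]_n).
Hypotheses (Gsym : G^T = G) (GGi : G *m Gi = 1%:M).

Let Gs i j : G i j = G j i. Proof. by rewrite -{1}Gsym mxE. Qed.

Lemma inv_mx_sym : Gi^T = Gi.
Proof.
have E : Gi^T *m G = 1%:M by rewrite -[in LHS]Gsym -trmx_mul GGi trmx1.
by rewrite -[LHS]mulmx1 -GGi mulmxA E mul1mx.
Qed.

Let GiG : Gi *m G = 1%:M. Proof. exact: mulmx1C. Qed.
Let Gis i j : Gi i j = Gi j i. Proof. by rewrite -{1}inv_mx_sym mxE. Qed.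

Lemma lower_raise (b : 'I_n -> A) p :
  \sum_m G p m * (\sum_l Gi m l * b l) = b p.
Proof.
pose v := (\col_l b l : 'cV[A]_n).
transitivity ((G *m (Gi *m v)) p 0).
  rewrite mxE; apply: eq_bigr => m _; rewrite mxE; congr (_ * _).
  by apply: eq_bigr => l _; rewrite mxE.
by rewrite mulmxA GGi mul1mx mxE.
Qed.

Lemma chr_lower p i j : \sum_m G p m * chr G Gi m i j = chrL G p i j.
Proof. exact: (lower_raise (fun l => chrL G l i j)). Qed.

Lemma chrLC l i j : chrL G l i j = chrL G l j i.
Proof. by rewrite /chrL (addrC (D i _)) (Gs i j). Qed.

Lemma chrC m i j : chr G Gi m i j = chr G Gi m j i.
Proof. by apply: eq_bigr => l _; rewrite chrLC. Qed.

(** Compatibility of the Levi-Civita connection with the metric, with all indices lowered. *)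
Lemma chrL_compat r i j : chrL G j r i + chrL G i r j = D r (G i j).
Proof.
rewrite /chrL -mulrDr [G j i]Gs [G r j]Gs [G r i]Gs.
rewrite -[RHS](half_mulD) -mulrDr; congr (_ * _); rewrite [G i r]Gs [G j r]Gs; ring.
Qed.

Lemma dmx_inv r : dmx r Gi = - (Gi *m dmx r G *m Gi).
Proof.
have := congr1 (dmx r) GiG; rewrite dmxM dmx1 => /eqP.
rewrite addr_eq0 => /eqP E.
by rewrite -[LHS]mulmx1 -GGi mulmxA E mulNmx.
Qed.

(** Parallelism of the inverse metric: compatibility splits [dmx r G] as [T + T^T], and multiplying
    by [Gi] on both sides raises the indices. *)
Lemma der_inv_entry r i j : D r (Gi i j) =
  - (\sum_a Gi i a * chr G Gi j r a) - \sum_a Gi j a * chr G Gi i r a.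
Proof.
pose T := \matrix_(a, b) chrL G b r a.
have dGE : dmx r G = T + T^T.
  by apply/matrixP=> a b; rewrite !mxE chrL_compat.
have -> : D r (Gi i j) = dmx r Gi i j by rewrite mxE.
have TE a b : (Gi *m T *m Gi) a b = \sum_c Gi a c * chr G Gi b r c.
  rewrite -mulmxA mxE; apply: eq_bigr => c _; rewrite mxE; congr (_ * _).
  by apply: eq_bigr => l _; rewrite !mxE mulrC Gis.
have E : Gi *m T^T *m Gi = (Gi *m T *m Gi)^T.
  by rewrite !trmx_mul inv_mx_sym mulmxA.
by rewrite dmx_inv dGE mulmxDr mulmxDl E mxE [in LHS]mxE [X in _ + X]mxE !TE opprD.
Qed.

(** [Gamma^r_ri] is the derivative of the logarithm of the volume density. *)
Definition logvol (i : 'I_n) := \sum_r chr G Gi r r i.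

Lemma logvolE i : logvol i = half * \tr (Gi *m dmx i G).
Proof.
have E : logvol i = \sum_r \sum_l Gi r l * chrL G r i l.
  rewrite /logvol /chr exchange_big /=; apply: eq_bigr => l _.
  by apply: eq_bigr => r _; rewrite Gis chrLC.
have E2 : logvol i = \sum_r \sum_l Gi r l * chrL G l i r.
  by apply: eq_bigr => r _; apply: eq_bigr => l _; rewrite chrLC.
rewrite -[LHS]mul1r -halfE mulrDl {1}E E2 -mulrDr; congr (_ * _).
rewrite -big_split /=; apply: eq_bigr => r _.
rewrite mxE -big_split /=; apply: eq_bigr => l _.
by rewrite -mulrDr addrC chrL_compat mxE Gs.
Qed.

(** The ring has no logarithm to differentiate twice. In the derivative of [logvolE] the term with
    second derivatives is symmetric because derivations commute, and the term from [dmx_inv] because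
    the trace is cyclic. *)
Lemma logvol_closed i j : D j (logvol i) = D i (logvol j).
Proof.
have E a b : D a (logvol b) =
    half * (\tr (Gi *m dmx a (dmx b G)) - \tr (Gi *m dmx a G *m Gi *m dmx b G)).
  rewrite logvolE DM der_half mul0r add0r der_mxtrace dmxM dmx_inv mulNmx.
  by rewrite mxtraceD raddfN addrC.
rewrite !E; congr (_ * (\tr (_ *m _) - _)).
  by apply/matrixP=> a b; rewrite !mxE DC.
by rewrite -mulmxA mxtrace_mulC mulmxA.
Qed.

(** The divergence of the inverse metric, divided by the volume density, is the first-order
    coefficient of the Laplacian. This gives the divergence form of Delta. *)
Lemma div_inv j : \sum_i D i (Gi i j) + \sum_i logvol i * Gi i j =
  - \sum_a \sum_b Gi a b * chr G Gi j a b.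
Proof.
have -> : \sum_i D i (Gi i j) =
    - (\sum_i \sum_a Gi i a * chr G Gi j i a)
    - \sum_i \sum_a Gi j a * chr G Gi i i a.
  rewrite -sumrN -sumrB; apply: eq_bigr => i _; exact: der_inv_entry.
rewrite -addrA addrC -[RHS]add0r; congr (_ + _); apply/eqP.
rewrite addrC subr_eq0; apply/eqP; rewrite [RHS]exchange_big /=.
by apply: eq_bigr => i _; rewrite mulrC -mulr_sumr Gis.
Qed.
End Derivations.

Section Kronecker.
Context (A : pzRingType) (n : nat).

Lemma sum_kronl (j : 'I_n) (F : 'I_n -> A) :
  \sum_l (l == j)%:R * F l = F j.
Proof.
rewrite (bigD1 j) //= eqxx mul1r big1 ?addr0 // => l /negPf->.
by rewrite mul0r.
Qed.

Lemma sum_kronr (j : 'I_n) (F : 'I_n -> A) :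
  \sum_l (j == l)%:R * F l = F j.
Proof.
by rewrite -[RHS]sum_kronl; apply: eq_bigr => l _; rewrite eq_sym.
Qed.
End Kronecker.

(** * Conformal change of the Levi-Civita connection and of the Ricci tensor *)

Section ConformalChange.
Context (A : comPzRingType) (n : nat) (D : 'I_n -> A -> A).
Hypothesis Dder : commuting_derivations D.
Context (half : A).
Hypothesis halfE : half + half = 1.
Context (G Gi : 'M[A]_n).
Hypotheses (Gsym : G^T = G) (GGi : G *m Gi = 1%:M).
Context (w : 'I_n -> A).

Let DD i a b : D i (a + b) = D i a + D i b. Proof. by case: Dder. Qed.
Let DM i a b : D i (a * b) = D i a * b + a * D i b. Proof. by case: Dder. Qed.
Let Gs i j : G i j = G j i. Proof. by rewrite -{1}Gsym mxE. Qed.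
Let GiG : Gi *m G = 1%:M. Proof. exact: mulmx1C. Qed.

Let W m := \sum_l Gi m l * w l.

(** The difference tensor of the connections of e^(2 omega) g and g when [w] is d omega; [W] is [w]
    with its index raised. As [w] is not assumed closed, an antisymmetric term survives in
    [ric_conformal]. *)
Definition conf_chr (m i j : 'I_n) :=
  (m == i)%:R * w j + (m == j)%:R * w i - G i j * W m.

Lemma chr_conformal (E Ei : A) : E * Ei = 1 ->
    (forall i, D i E = (w i + w i) * E) -> forall m i j,
  chr D half (E *: G) (Ei *: Gi) m i j = chr D half G Gi m i j + conf_chr m i j.
Proof.
move=> EEi DE m i j.
have chrLE l : chrL D half (E *: G) l i j =
    E * (chrL D half G l i j + (w j * G l i + w i * G l j - w l * G i j)).
  rewrite /chrL !mxE !DM !DE [G l j]Gs [G l i]Gs.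
  rewrite -[X in _ = E * (_ + X)](half_mulD halfE); ring.
rewrite /chr /conf_chr /W mulr_sumr.
have EE a b : Ei * a * (E * b) = a * b by rewrite mulrACA (mulrC Ei) EEi mul1r.
under eq_bigr do rewrite chrLE mxE EE mulrDr.
rewrite big_split /=; congr (_ + _).
under eq_bigr do rewrite mulrBr mulrDr.
rewrite sumrB big_split /=; congr (_ + _ - _); last first.
- by apply: eq_bigr => l _; rewrite [RHS]mulrC -mulrA; congr (_ * _); rewrite mulrC.
- have := congr1 (fun X : 'M[A]_n => X m j) GiG; rewrite !mxE => <-.
  by rewrite mulr_suml; apply: eq_bigr => l _; rewrite mulrA mulrAC.
have := congr1 (fun X : 'M[A]_n => X m i) GiG; rewrite !mxE => <-.
by rewrite mulr_suml; apply: eq_bigr => l _; rewrite mulrA mulrAC.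
Qed.

(** A polynomial in arbitrary connection coefficients and their derivatives, so that it can be
    expanded at [Ga + C]. *)
Definition ric (Ga : 'I_n -> 'I_n -> 'I_n -> A) (i j : 'I_n) :=
  \sum_r (D r (Ga r j i) - D j (Ga r r i)
          + \sum_l (Ga r r l * Ga l j i - Ga r j l * Ga l r i)).

Let N := \sum_l w l * W l.
Let Ga := chr D half G Gi.
Let C := conf_chr.

Let contr (g : 'I_n -> A) j s :
  \sum_l g l * C l j s = g j * w s + g s * w j - G j s * \sum_l g l * W l.
Proof.
rewrite mulr_sumr.
under eq_bigr => l _ do rewrite /C /conf_chr mulrBr mulrDr
  (mulrCA (g l)) [g l * ((l == s)%:R * _)]mulrCA (mulrCA (g l) (G _ _)).
by rewrite sumrB big_split /= !sum_kronl.
Qed.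

Let contr2 (X : 'I_n -> 'I_n -> A) j :
  \sum_r \sum_l C r j l * X l r =
  \sum_l w l * X l j + w j * (\sum_r X r r)
  - \sum_r W r * \sum_l G j l * X l r.
Proof.
have E r : \sum_l C r j l * X l r =
    (r == j)%:R * (\sum_l w l * X l r) + w j * X r r - W r * \sum_l G j l * X l r.
  rewrite !mulr_sumr -[w j * X r r](sum_kronr r (fun l => w j * X l r)).
  rewrite -big_split -sumrB /=; apply: eq_bigr => l _; rewrite /C /conf_chr; ring.
under eq_bigr do rewrite E.
by rewrite sumrB big_split /= sum_kronl mulr_sumr.
Qed.

Let trC s : \sum_r C r r s = n%:R * w s.
Proof.
rewrite /C /conf_chr; under eq_bigr do rewrite eqxx mul1r.
rewrite sumrB big_split /= sum_kronl sumr_const card_ord mulr_natl.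
have -> : \sum_r G r s * W r = w s.
  by rewrite -[RHS](lower_raise GGi); apply: eq_bigr => r _; rewrite Gs.
by rewrite addrK.
Qed.

(** The expansion has derivatives of [C] ([a1]), products of [Ga] with [C] ([c1] to [f1]) and
    quadratic terms ([q1], [q2]). The derivatives of [G] hidden in [a1] cancel against the
    first-kind symbols in [e1] and [f1]: this is metric compatibility, recorded in [g1]. *)
Lemma ric_conformal i j :
  ric (fun a b c => Ga a b c + C a b c) i j =
  ric Ga i j - (n%:R - 2) * (D j (w i) - \sum_l Ga l j i * w l - w j * w i)
  + (D i (w j) - D j (w i))
  - G j i * (\sum_r D r (W r) + \sum_r logvol D half G Gi r * W r + (n%:R - 2) * N).
Proof.
have -> : ric (fun a b c => Ga a b c + C a b c) i j = ric Ga i j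
    + (\sum_r D r (C r j i) - D j (\sum_r C r r i))
    + (\sum_r \sum_l Ga r r l * C l j i + \sum_r \sum_l C r r l * Ga l j i
       - \sum_r \sum_l Ga r j l * C l r i - \sum_r \sum_l C r j l * Ga l r i)
    + (\sum_r \sum_l C r r l * C l j i - \sum_r \sum_l C r j l * C l r i).
  rewrite /ric (der_sum Dder) -!(sumrB, big_split) /=; apply: eq_bigr => r _.
  rewrite !(DD _ (Ga _ _ _)).
  have -> : \sum_l ((Ga r r l + C r r l) * (Ga l j i + C l j i) -
                    (Ga r j l + C r j l) * (Ga l r i + C l r i)) =
      \sum_l (Ga r r l * Ga l j i - Ga r j l * Ga l r i)
      + (\sum_l Ga r r l * C l j i + \sum_l C r r l * Ga l j i
         - \sum_l Ga r j l * C l r i - \sum_l C r j l * Ga l r i)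
      + (\sum_l C r r l * C l j i - \sum_l C r j l * C l r i).
    rewrite -!(sumrB, big_split) /=; apply: eq_bigr => l _; ring.
  ring.
have a1 : \sum_r D r (C r j i) = D j (w i) + D i (w j)
    - \sum_r W r * D r (G j i) - G j i * \sum_r D r (W r).
  rewrite -(sum_kronl j (fun r => D r (w i))) -(sum_kronl i (fun r => D r (w j))).
  rewrite mulr_sumr -!(sumrB, big_split) /=; apply: eq_bigr => r _.
  rewrite /C /conf_chr (derB Dder) DD !DM !(der_nat Dder); ring.
have c1 : \sum_r \sum_l Ga r r l * C l j i =
    logvol D half G Gi j * w i + logvol D half G Gi i * w j
    - G j i * \sum_r logvol D half G Gi r * W r.
  rewrite -contr exchange_big /=; apply: eq_bigr => l _.
  by rewrite mulr_suml.
have d1 : \sum_r \sum_l C r r l * Ga l j i = n%:R * \sum_l Ga l j i * w l.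
  rewrite exchange_big /= mulr_sumr; apply: eq_bigr => l _.
  by rewrite -mulr_suml trC mulrAC mulrA.
have e1 : \sum_r \sum_l Ga r j l * C l r i =
    logvol D half G Gi j * w i + \sum_l Ga l j i * w l
    - \sum_r W r * chrL D half G i j r.
  have E r : \sum_l Ga r j l * C l r i =
      Ga r r j * w i + Ga r j i * w r - \sum_l G r i * (Ga r j l * W l).
    by rewrite contr mulr_sumr [Ga r j r]chrC.
  under eq_bigr do rewrite E.
  rewrite sumrB big_split /= -mulr_suml; congr (_ - _).
  rewrite exchange_big /=; apply: eq_bigr => l _.
  rewrite -(chr_lower D half GGi) mulr_sumr; apply: eq_bigr => r _.
  by rewrite [G i r]Gs /Ga; ring.
have f1 : \sum_r \sum_l C r j l * Ga l r i =
    \sum_l Ga l j i * w l + w j * logvol D half G Gi i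
    - \sum_r W r * chrL D half G j r i.
  rewrite contr2; congr (_ + _ - _).
    by apply: eq_bigr => l _; rewrite mulrC.
  by apply: eq_bigr => r _; rewrite (chr_lower D half GGi).
have q1 : \sum_r \sum_l C r r l * C l j i =
    n%:R * (w j * w i + w i * w j - G j i * N).
  rewrite -contr mulr_sumr exchange_big; apply: eq_bigr => l _ /=.
  by rewrite -mulr_suml trC mulrA.
have q2 : \sum_r \sum_l C r j l * C l r i =
    (n%:R + 2) * (w j * w i) - 2 * (G j i * N).
  rewrite contr2 contr trC.
  have E r : \sum_l G j l * C l r i = G j r * w i + G j i * w r - G r i * w j.
    by rewrite contr (lower_raise GGi).
  have T a : \sum_r G a r * W r = w a by exact: (lower_raise GGi).
  have -> : \sum_r W r * (\sum_l G j l * C l r i) =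
      (\sum_r G j r * W r) * w i + G j i * (\sum_r w r * W r)
      - (\sum_r G i r * W r) * w j.
    rewrite !mulr_suml mulr_sumr -!(sumrB, big_split) /=.
    by apply: eq_bigr => r _; rewrite E [G i r]Gs; ring.
  rewrite !T -/N; ring.
have g1 : \sum_r W r * D r (G j i) =
    \sum_r W r * chrL D half G i j r + \sum_r W r * chrL D half G j r i.
  rewrite -big_split; apply: eq_bigr => r _ /=.
  by rewrite -mulrDr -(chrL_compat D halfE Gsym r j i) [chrL _ _ _ i _ _]chrLC.
rewrite a1 trC c1 d1 e1 f1 q1 q2 g1 DM (der_nat Dder); ring.
Qed.
End ConformalChange.

(** * Hessian and Laplacian, and the comparison of two Einstein equations *)

Section Hessian.
Context (A : comPzRingType) (n : nat) (D : 'I_n -> A -> A).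
Hypothesis Dder : commuting_derivations D.
Context (half : A).
Hypothesis halfE : half + half = 1.
Context (G Gi : 'M[A]_n).
Hypotheses (Gsym : G^T = G) (GGi : G *m Gi = 1%:M).

Let DD i a b : D i (a + b) = D i a + D i b. Proof. by case: Dder. Qed.
Let DM i a b : D i (a * b) = D i a * b + a * D i b. Proof. by case: Dder. Qed.
Let DC i j a : D i (D j a) = D j (D i a). Proof. by case: Dder. Qed.
Let Gs i j : G i j = G j i. Proof. by rewrite -{1}Gsym mxE. Qed.
Let Gis i j : Gi i j = Gi j i.
Proof. by rewrite -{1}(inv_mx_sym Gsym GGi) mxE. Qed.
Local Notation Ga := (chr D half G Gi).

Definition hess (u : A) (i j : 'I_n) :=
  D i (D j u) - \sum_m Ga m i j * D m u.

Definition lap (u : A) := \sum_i \sum_j Gi i j * hess u i j.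

Definition grad (u : A) (i : 'I_n) := \sum_j Gi i j * D j u.

Definition dot (u v : A) := \sum_i D i u * grad v i.

Lemma dotE u v : dot u v = \sum_i D i u * \sum_j Gi i j * D j v.
Proof. by []. Qed.

Lemma dotC u v : dot u v = dot v u.
Proof.
rewrite /dot /grad; under eq_bigr do rewrite mulr_sumr.
rewrite exchange_big; apply: eq_bigr => i _; rewrite mulr_sumr.
by apply: eq_bigr => j _; rewrite [Gi j i]Gis; ring.
Qed.

Lemma dotMl u v t : dot (u * v) t = u * dot v t + v * dot u t.
Proof.
by rewrite !mulr_sumr -big_split; apply: eq_bigr => i _; rewrite DM /=; ring.
Qed.

Lemma hessD u v i j : hess (u + v) i j = hess u i j + hess v i j.
Proof.
have -> : hess u i j + hess v i j = D i (D j (u + v))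
    - (\sum_m Ga m i j * D m u + \sum_m Ga m i j * D m v) by rewrite /hess !DD; ring.
rewrite -big_split; congr (_ - _); apply: eq_bigr => m _ /=.
by rewrite DD mulrDr.
Qed.

Lemma hessM u v i j : hess (u * v) i j =
  u * hess v i j + v * hess u i j + (D i u * D j v + D j u * D i v).
Proof.
have -> : hess (u * v) i j = D i (D j (u * v))
    - (u * (\sum_m Ga m i j * D m v) + v * (\sum_m Ga m i j * D m u)).
  rewrite !mulr_sumr -big_split; congr (_ - _); apply: eq_bigr => m _ /=.
  by rewrite DM; ring.
by rewrite /hess !(DM, DD); ring.
Qed.

Lemma lapD u v : lap (u + v) = lap u + lap v.
Proof.
rewrite -big_split; apply: eq_bigr => i _; rewrite -big_split.
by apply: eq_bigr => j _ /=; rewrite hessD mulrDr.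
Qed.

Lemma lapM u v : lap (u * v) = u * lap v + v * lap u + 2 * dot u v.
Proof.
have -> : 2 * dot u v = dot u v + dot v u by rewrite (dotC v); ring.
rewrite /lap /dot /grad !mulr_sumr -!big_split; apply: eq_bigr => i _ /=.
rewrite !mulr_sumr -!big_split; apply: eq_bigr => j _ /=.
by rewrite hessM; ring.
Qed.

Lemma lap_expand u : lap u = \sum_i \sum_j Gi i j * D i (D j u)
  - \sum_j (\sum_a \sum_b Gi a b * Ga j a b) * D j u.
Proof.
have -> : \sum_j (\sum_a \sum_b Gi a b * Ga j a b) * D j u =
    \sum_a \sum_b Gi a b * \sum_j Ga j a b * D j u.
  under eq_bigr do rewrite mulr_suml.
  rewrite exchange_big; apply: eq_bigr => a _ /=.
  under eq_bigr do rewrite mulr_suml.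
  rewrite exchange_big; apply: eq_bigr => b _ /=; rewrite mulr_sumr.
  by apply: eq_bigr => j _; rewrite mulrA.
rewrite -sumrB; apply: eq_bigr => i _; rewrite -sumrB.
by apply: eq_bigr => j _; rewrite mulrBr.
Qed.

(** The divergence form of the Laplacian, from [div_inv]. It identifies the divergence that
    [ric_conformal] produces with Delta omega. *)
Lemma div_grad u :
  \sum_r D r (grad u r) + \sum_r logvol D half G Gi r * grad u r = lap u.
Proof.
rewrite lap_expand -sumrN.
under [X in _ = _ + X]eq_bigr do rewrite -mulNr -(div_inv Dder halfE Gsym GGi).
under [X in _ = _ + X]eq_bigr do rewrite mulrDl !mulr_suml.
rewrite big_split /= addrA; congr (_ + _).
  rewrite [X in _ = _ + X]exchange_big -big_split; apply: eq_bigr => r _ /=.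
  rewrite /grad (der_sum Dder) -big_split; apply: eq_bigr => j _ /=.
  by rewrite DM addrC.
rewrite exchange_big; apply: eq_bigr => r _; rewrite /grad mulr_sumr.
by apply: eq_bigr => j _; rewrite mulrA.
Qed.

Lemma trace_metric : \sum_i \sum_j Gi i j * G i j = n%:R.
Proof.
have <- : \tr (1%:M : 'M[A]_n) = n%:R by rewrite mxtrace1.
rewrite -GGi; apply: eq_bigr => i _; rewrite mxE; apply: eq_bigr => j _.
by rewrite mulrC Gis.
Qed.

(** The two Einstein equations determine the trace-free part and the trace of
    the Hessian of [om], hence the Hessian of [s = exp (- om)]. *)
Lemma einstein_hess (om s E lam lamh : A) :
    (forall a : A, (n%:R - 1) * a = 0 -> a = 0) ->
    (forall a : A, (n%:R - 2) * a = 0 -> a = 0) ->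
    E * s ^+ 2 = 1 ->
    (forall i, D i s = - s * D i om) ->
    (forall i, D i E = (D i om + D i om) * E) ->
    (forall i j, ric D Ga i j = lam * (n%:R - 1) * G i j) ->
    (forall i j, ric D (chr D half (E *: G) (s ^+ 2 *: Gi)) i j
       = lamh * (n%:R - 1) * (E *: G) i j) ->
  forall i j, 2 * s * hess s i j = (dot s s - lam * s ^+ 2 + lamh) * G i j.
Proof.
move=> n1 n2 Es Ds DE hg hgh.
pose w i := D i om; pose N := dot om om; pose T := lap om.
(* For s = exp (- omega) the Hessian is - s [H], so it suffices to determine [H]. *)
pose H i j := hess om i j - w i * w j.
pose L := lamh * E - lam.
have key i j : (n%:R - 1) * L * G i j + (n%:R - 2) * H i j
    + (T + (n%:R - 2) * N) * G i j = 0.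
  have := hgh j i.
  have -> : ric D (chr D half (E *: G) (s ^+ 2 *: Gi)) j i =
      ric D (fun a b c => Ga a b c + conf_chr G Gi w a b c) j i.
    have C := chr_conformal Dder halfE Gsym GGi Es DE.
    apply: eq_bigr => r _; rewrite -C; congr (D _ _ - D _ _ + _); rewrite ?C //.
    by apply: eq_bigr => l _; rewrite !C.
  rewrite (ric_conformal Dder halfE Gsym GGi) hg.
  have -> : \sum_r D r (\sum_l Gi r l * w l) +
     \sum_r logvol D half G Gi r * (\sum_l Gi r l * w l) = T by rewrite div_grad.
  rewrite (_ : \sum_l w l * _ = N) // (_ : D i (w j) - _ - _ = H i j) //.
  rewrite {1}/w DC subrr addr0 mxE [G j i]Gs => e.
  transitivity (lamh * (n%:R - 1) * (E * G i j) - lamh * (n%:R - 1) * (E * G i j)).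
rewrite -{2}e /L. ring.
  by rewrite subrr.
(* The trace of [key] is n - 1 times this expression, and [n1] cancels the factor. *)
have tr : n%:R * L + 2 * T + (n%:R - 2) * N = 0.
  apply: n1; have trH : \sum_i \sum_j Gi i j * H i j = T - N.
    rewrite /T /N /lap /dot -sumrB; apply: eq_bigr => i _.
    rewrite /grad mulr_sumr -sumrB; apply: eq_bigr => j _.
    by rewrite /H /w; ring.
  have : \sum_i \sum_j Gi i j * ((n%:R - 1) * L * G i j + (n%:R - 2) * H i j
    + (T + (n%:R - 2) * N) * G i j) = 0.
    by rewrite big1 // => i _; rewrite big1 // => j _; rewrite key mulr0.
  have -> a b c : \sum_i \sum_j Gi i j * (a * G i j + b * H i j + c * G i j) =
      (a + c) * (\sum_i \sum_j Gi i j * G i j) + b * \sum_i \sum_j Gi i j * H i j.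
    rewrite !mulr_sumr -big_split; apply: eq_bigr => i _ /=.
    rewrite !mulr_sumr -big_split; apply: eq_bigr => j _ /=; ring.
  by rewrite trace_metric trH => <-; ring.
move=> i j.
(* Eliminating Delta omega between [key] and [tr] leaves n - 2 times this expression; here the
   dimension has to differ from 2. *)
have Hij : 2 * H i j + (L + N) * G i j = 0.
  apply: n2; transitivity (2 * ((n%:R - 1) * L * G i j + (n%:R - 2) * H i j
    + (T + (n%:R - 2) * N) * G i j)
    - (n%:R * L + 2 * T + (n%:R - 2) * N) * G i j); first by ring.
  by rewrite key tr mulr0 mul0r subr0.
have hs : hess s i j = - s * H i j.
  rewrite /hess DC Ds (DM j) (derN Dder) !Ds /H /hess.
  have -> : \sum_m Ga m i j * D m s = - s * \sum_m Ga m i j * D m om.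
    by rewrite mulr_sumr; apply: eq_bigr => m _; rewrite Ds; ring.
  by rewrite DC /w; ring.
have ds : dot s s = s ^+ 2 * N.
  rewrite /N /dot mulr_sumr; apply: eq_bigr => r _.
  have -> : grad s r = - s * grad om r.
    by rewrite /grad mulr_sumr; apply: eq_bigr => m _; rewrite Ds; ring.
  by rewrite Ds; ring.
have -> : 2 * s * hess s i j = - s ^+ 2 * (2 * H i j) by rewrite hs; ring.
have -> : 2 * H i j = - (L + N) * G i j.
  by apply/eqP; rewrite -subr_eq0 mulNr opprK Hij.
rewrite ds /L -[lamh in RHS]mulr1 -Es; ring.
Qed.
End Hessian.

(** * The Laplacian and a vector field [v] with covariant derivative f times the identity *)

Section ConformalField.
Context (A : comPzRingType) (n : nat) (D : 'I_n -> A -> A).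
Hypothesis Dder : commuting_derivations D.
Context (half : A).
Hypothesis halfE : half + half = 1.
Context (G Gi : 'M[A]_n).
Hypotheses (Gsym : G^T = G) (GGi : G *m Gi = 1%:M).

Let DD i a b : D i (a + b) = D i a + D i b. Proof. by case: Dder. Qed.
Let DM i a b : D i (a * b) = D i a * b + a * D i b. Proof. by case: Dder. Qed.
Let DC i j a : D i (D j a) = D j (D i a). Proof. by case: Dder. Qed.
Let Gis i j : Gi i j = Gi j i.
Proof. by rewrite -{1}(inv_mx_sym Gsym GGi) mxE. Qed.
Local Notation Ga := (chr D half G Gi).
Local Notation Lap := (lap D half G Gi).
Local Notation Grad := (grad D Gi).
Local Notation Dot := (dot D Gi).
Local Notation logvol := (logvol D half G Gi).
Local Notation invE := (der_inv_entry Dder halfE Gsym GGi).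

Let lap0 : Lap 0 = 0.
Proof.
by apply: (addrI (Lap 0)); rewrite -lapD // !addr0.
Qed.

Let lap_sum (F : 'I_n -> A) : Lap (\sum_i F i) = \sum_i Lap (F i).
Proof. exact: (big_morph Lap (lapD Dder half G Gi) lap0). Qed.

Context (v : 'I_n -> A) (f : A).
Hypothesis Dv : forall a i, D a (v i) = (a == i)%:R * f - \sum_b Ga i a b * v b.

(** The first-order coefficients of Delta = g^ij d_i d_j + b^j d_j. *)
Let b j := - \sum_c \sum_d Gi c d * Ga j c d.

Let lapE u : Lap u = \sum_i \sum_j Gi i j * D i (D j u) + \sum_j b j * D j u.
Proof.
rewrite lap_expand -sumrN; congr (_ + _); apply: eq_bigr => j _.
by rewrite /b mulNr.
Qed.

Let bE j : b j = \sum_i (D i (Gi i j) + logvol i * Gi i j).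
Proof. by rewrite big_split /= (div_inv Dder halfE Gsym GGi). Qed.

(** The Lie derivative of the inverse metric along [v] is - 2 f times the inverse metric, written in
    coordinates. *)
Let lie_inv i j : \sum_a v a * D a (Gi i j) =
  \sum_a D a (v i) * Gi a j + \sum_a D a (v j) * Gi a i - 2 * f * Gi i j.
Proof.
have E x y : \sum_a D a (v x) * Gi a y =
    f * Gi x y - \sum_a v a * \sum_c Gi y c * Ga x a c.
  under [X in _ - X]eq_bigr do rewrite mulr_sumr.
  rewrite [X in _ - X]exchange_big /= -(sum_kronl x (fun a => f * Gi a y)).
  rewrite -sumrB; apply: eq_bigr => a _.
  rewrite Dv mulrBl mulrA; congr (_ - _); rewrite mulr_suml.
  apply: eq_bigr => c _; rewrite [Ga x a c](chrC D half _ Gsym) [Gi y a]Gis; ring.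
rewrite !E [Gi j i]Gis.
have -> : \sum_a v a * D a (Gi i j) =
    - (\sum_a v a * \sum_c Gi i c * Ga j a c)
    - \sum_a v a * \sum_c Gi j c * Ga i a c.
  rewrite -sumrN -sumrB; apply: eq_bigr => a _; rewrite invE; ring.
ring.
Qed.

Let div_v : \sum_i (D i (v i) + logvol i * v i) = n%:R * f.
Proof.
rewrite big_split /=; under eq_bigr do rewrite Dv eqxx mul1r.
rewrite sumrB sumr_const card_ord exchange_big /= mulr_natl -addrA.
rewrite [X in _ + X](_ : _ = 0) ?addr0 //; apply/eqP; rewrite addrC subr_eq0.
by apply/eqP; apply: eq_bigr => c _; rewrite /logvol mulr_suml.
Qed.

(** Obtained by differentiating the divergence form [bE] along [v]. Of the gradient of f, n copies
    come from differentiating div v = n f, which needs [logvol_closed], and - 2 copies from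
    differentiating the factor 2 f of [lie_inv]. *)
Let lie_b j : \sum_a v a * D a (b j) = (n%:R - 2) * Grad f j + Lap (v j) - 2 * f * b j.
Proof.
have gradE : n%:R * Grad f j =
    \sum_a Gi a j * \sum_i (D i (D a (v i)) + v i * D i (logvol a)
                            + logvol i * D a (v i)).
  rewrite mulr_sumr; apply: eq_bigr => a _.
  rewrite Gis mulrCA; congr (_ * _).
  have -> : n%:R * D a f = D a (n%:R * f) by rewrite DM (der_nat Dder); ring.
  rewrite -div_v (der_sum Dder); apply: eq_bigr => i _.
  by rewrite DD DM DC (logvol_closed Dder halfE Gsym GGi); ring.
have -> : \sum_a v a * D a (b j) =
    \sum_i (D i (\sum_a v a * D a (Gi i j)) - \sum_a D i (v a) * D a (Gi i j)
      + (\sum_a v a * D a (logvol i)) * Gi i j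
      + logvol i * \sum_a v a * D a (Gi i j)).
  transitivity (\sum_i \sum_a (v a * D a (D i (Gi i j) + logvol i * Gi i j))).
    rewrite exchange_big; apply: eq_bigr => a _ /=.
    by rewrite bE (der_sum Dder) mulr_sumr.
  apply: eq_bigr => i _.
  rewrite (der_sum Dder) mulr_suml mulr_sumr -!(sumrB, big_split) /=.
  by apply: eq_bigr => a _; rewrite DD !DM [D i (D a _)]DC; ring.
have T1 : \sum_i \sum_a D i (v a) * D a (Gi i j) =
          \sum_i \sum_a D a (v i) * D i (Gi a j) by rewrite exchange_big.
transitivity (
    \sum_i \sum_a Gi a j * (D i (D a (v i)) + v i * D i (logvol a)
                            + logvol i * D a (v i))
  + (\sum_i \sum_a D a (v i) * D i (Gi a j) - \sum_i \sum_a D i (v a) * D a (Gi i j))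
  + \sum_i \sum_a Gi i a * D i (D a (v j))
  + \sum_a \sum_i (D i (Gi i a) + logvol i * Gi i a) * D a (v j)
  - 2 * \sum_i Gi j i * D i f
  - 2 * f * \sum_i (D i (Gi i j) + logvol i * Gi i j)).
  have T2 : \sum_i (\sum_a v a * D a (logvol i)) * Gi i j =
            \sum_i \sum_a v i * D i (logvol a) * Gi a j.
    by rewrite exchange_big; apply: eq_bigr => i _; rewrite mulr_suml.
  rewrite big_split /= big_split /= T2.
  rewrite [X in _ = _ + X - _ - _]exchange_big /= !mulr_sumr.
  rewrite -!(sumrB, big_split) /=; apply: eq_bigr => i _.
  have DS x y : D i (\sum_a D a (v x) * Gi a y) =
      \sum_a D i (D a (v x)) * Gi a y + \sum_a D a (v x) * D i (Gi a y).
    by rewrite (der_sum Dder) -big_split; apply: eq_bigr => a _; rewrite DM.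
  have R1 : \sum_a Gi a j * (D i (D a (v i)) + v i * D i (logvol a)
                            + logvol i * D a (v i)) =
      \sum_a D i (D a (v i)) * Gi a j + \sum_a v i * D i (logvol a) * Gi a j
      + logvol i * \sum_a D a (v i) * Gi a j.
    rewrite mulr_sumr -!big_split; apply: eq_bigr => a _ /=; ring.
  have R2 : \sum_a (D i (Gi i a) + logvol i * Gi i a) * D a (v j) =
      \sum_a D a (v j) * D i (Gi a i) + logvol i * \sum_a D a (v j) * Gi a i.
    rewrite mulr_sumr -!big_split; apply: eq_bigr => a _ /=.
    by rewrite [Gi i a]Gis; ring.
  have R3 : \sum_a Gi i a * D i (D a (v j)) = \sum_a D i (D a (v j)) * Gi a i.
    by apply: eq_bigr => a _; rewrite mulrC Gis.
  rewrite R1 R2 R3 lie_inv (derB Dder) DD !DS !DM (der_nat Dder) [Gi j i]Gis.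
  ring.
rewrite T1 subrr addr0 -bE /Grad [in RHS]lapE.
rewrite exchange_big /=.
under eq_bigr do rewrite -mulr_sumr.
rewrite -gradE /Grad.
under [X in _ + X - _ - _]eq_bigr do rewrite -mulr_suml -bE.
ring.
Qed.

(** The commutator of Delta with [v] is read off from the derivatives along [v] of the coefficients
    of Delta: [lie_inv] for the second order, [lie_b] for the first. No commutation of covariant
    derivatives is involved. *)
Lemma lap_conformal_field u :
  Lap (\sum_i v i * D i u) =
  \sum_i v i * D i (Lap u) + 2 * f * Lap u - (n%:R - 2) * Dot u f.
Proof.
have Dlap m : D m (Lap u) = Lap (D m u)
    + \sum_i \sum_j D m (Gi i j) * D i (D j u) + \sum_j D m (b j) * D j u.
  rewrite [Lap (D m u)]lapE [Lap u]lapE DD !(der_sum Dder).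
  under eq_bigr do rewrite (der_sum Dder).
  transitivity (\sum_i \sum_j (D m (Gi i j) * D i (D j u) + Gi i j * D i (D j (D m u)))
    + \sum_j (D m (b j) * D j u + b j * D j (D m u))).
    congr (_ + _); apply: eq_bigr => i _; last by rewrite DM DC.
    apply: eq_bigr => j _; rewrite DM (DC m i) (DC m j); ring.
  rewrite big_split /=; under eq_bigr do rewrite big_split /=.
  rewrite big_split /=; ring.
have V : \sum_i v i * D i (Lap u) = \sum_i v i * Lap (D i u)
    + \sum_i \sum_j (\sum_a v a * D a (Gi i j)) * D i (D j u)
    + \sum_j (\sum_a v a * D a (b j)) * D j u.
  under eq_bigr do rewrite Dlap !mulrDr.
  rewrite !big_split /=; congr (_ + _ + _).
    under eq_bigr do rewrite mulr_sumr.
    rewrite exchange_big; apply: eq_bigr => i _ /=.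
    under eq_bigr do rewrite mulr_sumr.
    rewrite exchange_big; apply: eq_bigr => j _ /=; rewrite mulr_suml.
    by apply: eq_bigr => a _; rewrite mulrA.
  under eq_bigr do rewrite mulr_sumr.
  rewrite exchange_big; apply: eq_bigr => j _ /=; rewrite mulr_suml.
  by apply: eq_bigr => a _; rewrite mulrA.
have V2 : \sum_i \sum_j (\sum_a v a * D a (Gi i j)) * D i (D j u) =
    2 * \sum_m Dot (v m) (D m u)
    - 2 * f * \sum_i \sum_j Gi i j * D i (D j u).
  have V3 : \sum_m Dot (v m) (D m u) =
      \sum_i \sum_j (\sum_a D a (v i) * Gi a j) * D i (D j u).
    apply: eq_bigr => m _; rewrite dotE.
    under eq_bigr do rewrite mulr_sumr.
    rewrite exchange_big; apply: eq_bigr => j _ /=; rewrite mulr_suml.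
    by apply: eq_bigr => a _; rewrite [D j _]DC; ring.
  have V4 : \sum_m Dot (v m) (D m u) =
      \sum_i \sum_j (\sum_a D a (v j) * Gi a i) * D i (D j u).
    rewrite V3 exchange_big; apply: eq_bigr => i _ /=; apply: eq_bigr => j _.
    by rewrite DC.
  rewrite mulr_natl mulr2n {1}V3 V4 mulr_sumr -!(big_split, sumrB) /=.
  apply: eq_bigr => i _; rewrite mulr_sumr -!(big_split, sumrB) /=.
  by apply: eq_bigr => j _; rewrite lie_inv; ring.
(* The components of [v] are treated as scalar functions; the non-tensorial terms [Lap (v i)] cancel
   against those of [lie_b]. *)
rewrite V V2 lap_sum.
under eq_bigr do rewrite (lapM Dder half Gsym GGi).
rewrite !big_split /= -[\sum_i 2 * _]mulr_sumr [Lap u in RHS]lapE.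
have -> : \sum_j (\sum_a v a * D a (b j)) * D j u =
    (n%:R - 2) * Dot u f + \sum_i D i u * Lap (v i) - 2 * f * \sum_j b j * D j u.
  rewrite !mulr_sumr -!(big_split, sumrB) /=; apply: eq_bigr => j _.
  by rewrite lie_b; ring.
ring.
Qed.
End ConformalField.

(** * The Laplacian of a conformal metric, and exponentials of omega *)

Section ConformalLaplacian.
Context (A : comPzRingType) (n : nat) (D : 'I_n -> A -> A).
Hypothesis Dder : commuting_derivations D.
Context (half : A).
Hypothesis halfE : half + half = 1.
Context (G Gi : 'M[A]_n).
Hypotheses (Gsym : G^T = G) (GGi : G *m Gi = 1%:M).
Context (om s E : A).
Hypothesis Es : E * s ^+ 2 = 1.
Hypothesis DE : forall i, D i E = (D i om + D i om) * E.

Let DM i a b : D i (a * b) = D i a * b + a * D i b. Proof. by case: Dder. Qed.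
Local Notation Lap := (lap D half G Gi).
Local Notation Dot := (dot D Gi).
Local Notation Hess := (hess D half G Gi).

(** The Hessian of [u] changes by the difference tensor applied to du. In its trace the two
    symmetric terms contribute - 2 and the metric term contributes n. *)
Lemma lap_conformal u :
  lap D half (E *: G) (s ^+ 2 *: Gi) u =
  s ^+ 2 * (Lap u + (n%:R - 2) * Dot u om).
Proof.
have H i j : hess D half (E *: G) (s ^+ 2 *: Gi) u i j = Hess u i j
    - (D i u * D j om + D j u * D i om - G i j * Dot u om).
  have -> : D i u * D j om + D j u * D i om - G i j * Dot u om =
      \sum_m conf_chr G Gi (D^~ om) m i j * D m u.
    rewrite -(sum_kronl i (fun m => D m u * D j om)).
    rewrite -(sum_kronl j (fun m => D m u * D i om)) dotE mulr_sumr.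
    rewrite -!(sumrB, big_split) /=; apply: eq_bigr => m _.
    by rewrite /conf_chr; ring.
  rewrite /hess -addrA -opprD -big_split; congr (_ - _).
  apply: eq_bigr => m _ /=.
  by rewrite (chr_conformal Dder halfE Gsym GGi Es DE); ring.
transitivity (s ^+ 2 * (Lap u - (Dot u om + Dot om u)
    + (\sum_i \sum_j Gi i j * G i j) * Dot u om)); last first.
  by rewrite (trace_metric Gsym GGi) (dotC D Gsym GGi om); ring.
rewrite /lap !dotE mulr_suml -!(sumrB, big_split) mulr_sumr /=.
apply: eq_bigr => i _.
rewrite mulr_suml !(mulr_sumr, big_split) /= -!(sumrB, big_split) mulr_sumr /=.
by apply: eq_bigr => j _; rewrite H mxE dotE; ring.
Qed.

(** [b] stands for e^(t omega); in a ring without exponentials it is known only through its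
    differential. *)
Lemma lap_exp t b : (forall i, D i t = 0) -> (forall i, D i b = t * b * D i om) ->
  Lap b = t * b * Lap om + t ^+ 2 * b * Dot om om.
Proof.
move=> Dt Db; rewrite /lap dotE !mulr_sumr -big_split; apply: eq_bigr => i _ /=.
rewrite !mulr_sumr -big_split; apply: eq_bigr => j _ /=.
have -> : Hess b i j = t * b * Hess om i j + t ^+ 2 * b * (D i om * D j om).
  have -> : Hess b i j = D i (D j b) - t * b * \sum_m chr D half G Gi m i j * D m om.
    rewrite mulr_sumr; congr (_ - _); apply: eq_bigr => m _; rewrite Db; ring.
  by rewrite /hess Db !DM Db Dt; ring.
ring.
Qed.

Lemma dot_exp t b u : (forall i, D i b = t * b * D i om) ->
  Dot b u = t * b * Dot om u.
Proof.
move=> Db; rewrite !dotE mulr_sumr; apply: eq_bigr => i _.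
by rewrite Db; ring.
Qed.
End ConformalLaplacian.

(** * Functions with Hess s = f h, their commutators with Delta, and the operators Q_l *)

Section Concircular.
Context (A : comPzRingType) (k : nat) (D : 'I_k -> A -> A).
Hypothesis Dder : commuting_derivations D.
Context (half : A).
Hypothesis halfE : half + half = 1.
Context (G Gi : 'M[A]_k).
Hypotheses (Gsym : G^T = G) (GGi : G *m Gi = 1%:M).

Let DD i a b : D i (a + b) = D i a + D i b. Proof. by case: Dder. Qed.
Let DM i a b : D i (a * b) = D i a * b + a * D i b. Proof. by case: Dder. Qed.
Let Gis i j : Gi i j = Gi j i.
Proof. by rewrite -{1}(inv_mx_sym Gsym GGi) mxE. Qed.
Let GiG : Gi *m G = 1%:M. Proof. exact: mulmx1C. Qed.
Local Notation Ga := (chr D half G Gi).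
Local Notation Lap := (lap D half G Gi).
Local Notation Grad := (grad D Gi).
Local Notation Dot := (dot D Gi).
Local Notation Hess := (hess D half G Gi).

(** The covariant derivative of a gradient is the Hessian with one index raised. For [s] it is f
    times the identity, so [lap_conformal_field] applies to grad s. *)
Lemma der_grad u a i :
  D a (Grad u i) = \sum_c Gi i c * Hess u a c - \sum_c Ga i a c * Grad u c.
Proof.
rewrite /grad (der_sum Dder).
have -> : \sum_c Ga i a c * (\sum_j Gi c j * D j u) =
          \sum_j (\sum_c Gi j c * Ga i a c) * D j u.
  under eq_bigr do rewrite mulr_sumr.
  rewrite exchange_big; apply: eq_bigr => j _ /=; rewrite mulr_suml.
  by apply: eq_bigr => c _; rewrite [Gi j c]Gis; ring.
have -> : \sum_c Gi i c * Hess u a c = \sum_c Gi i c * D a (D c u)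
    - \sum_j (\sum_c Gi i c * Ga j a c) * D j u.
  under [X in _ - X]eq_bigr do rewrite mulr_suml.
  rewrite [X in _ - X]exchange_big -sumrB; apply: eq_bigr => c _ /=.
  rewrite /hess mulrBr mulr_sumr; congr (_ - _).
  by apply: eq_bigr => j _; rewrite mulrA.
rewrite -!sumrB; apply: eq_bigr => j _.
by rewrite DM (der_inv_entry Dder halfE Gsym GGi); ring.
Qed.

Context (s f lam lamh : A).
Hypotheses (Dlam : forall i, D i lam = 0) (Dlamh : forall i, D i lamh = 0).
Hypothesis s_reg : forall a, 2 * s * a = 0 -> a = 0.
Hypothesis hess_s : forall i j, Hess s i j = f * G i j.
Hypothesis fE : 2 * s * f = Dot s s - lam * s ^+ 2 + lamh.

Let GiGE i a : \sum_c Gi i c * G a c = (a == i)%:R.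
Proof.
have := congr1 (fun X : 'M[A]_k => X i a) GiG; rewrite !mxE eq_sym => <-.
by apply: eq_bigr => c _; rewrite -{1}Gsym mxE.
Qed.

Let grad_s a i : D a (Grad s i) = (a == i)%:R * f - \sum_b Ga i a b * Grad s b.
Proof.
rewrite der_grad -GiGE mulr_suml; congr (_ - _); apply: eq_bigr => c _.
by rewrite hess_s; ring.
Qed.

(** Hess s = f h gives d|ds|^2 = 2 f ds. Differentiating [fE] then cancels the terms 2 f ds and
    leaves 2 s (df + lambda ds) = 0. *)
Lemma der_f i : D i f = - lam * D i s.
Proof.
have Dd : D i (Dot s s) = 2 * f * D i s.
  rewrite dotE (der_sum Dder).
  have -> : \sum_j D i (D j s * Grad s j) = \sum_j D i (D j s) * Grad s j
     + (f * D i s - \sum_j \sum_b Ga j i b * Grad s b * D j s).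
    rewrite -(sum_kronr i (fun j => D j s)) mulr_sumr -!(sumrB, big_split).
    by apply: eq_bigr => j _ /=; rewrite DM grad_s -mulr_suml; ring.
  have -> : \sum_j D i (D j s) * Grad s j = \sum_j Hess s i j * Grad s j
     + \sum_j \sum_b Ga j i b * Grad s b * D j s.
    rewrite exchange_big -big_split; apply: eq_bigr => j _ /=.
    rewrite -[D i _](subrK (\sum_m Ga m i j * D m s)) mulrDl; congr (_ + _).
    by rewrite mulr_suml; apply: eq_bigr => b _; ring.
  have -> : \sum_j Hess s i j * Grad s j = f * D i s.
    have -> : D i s = \sum_j G i j * Grad s j.
      by rewrite [RHS](lower_raise GGi).
    by rewrite mulr_sumr; apply: eq_bigr => j _; rewrite hess_s; ring.
  ring.
have := congr1 (D i) fE; rewrite !(DD, DM, derN Dder) Dd Dlam Dlamh (der1 Dder) => e.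
rewrite -[RHS]add0r; apply/eqP; rewrite -subr_eq; apply/eqP; apply: s_reg.
transitivity ((((0 + 0) * s + 2 * D i s) * f + 2 * s * D i f) - 2 * f * D i s
  + 2 * lam * s * D i s); first by ring.
by rewrite e; ring.
Qed.

Lemma lap_s : Lap s = k%:R * f.
Proof.
rewrite -(trace_metric Gsym GGi) mulr_suml; apply: eq_bigr => i _.
by rewrite mulr_suml; apply: eq_bigr => j _; rewrite hess_s; ring.
Qed.

Let dot_f u : Dot u f = - lam * Dot u s.
Proof.
rewrite (dotC D Gsym GGi u f) (dotC D Gsym GGi u s) !dotE mulr_sumr.
by apply: eq_bigr => i _; rewrite der_f mulrA.
Qed.

(** The commutator [Delta, s], written out: its zeroth-order coefficient is Delta s = k f. *)
Definition commZ u := 2 * Dot u s + k%:R * f * u.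
Local Notation Z := commZ.

Lemma lap_mul_s u : Lap (s * u) = s * Lap u + Z u.
Proof.
by rewrite (lapM Dder half Gsym GGi) lap_s (dotC D Gsym GGi s) /commZ; ring.
Qed.

Let lap_const c u : (forall i, D i c = 0) -> Lap (c * u) = c * Lap u.
Proof.
move=> Dc; have D0 v : Dot c v = 0.
  by rewrite dotE big1 // => i _; rewrite Dc mul0r.
have L0 : Lap c = 0.
  apply: big1 => i _; apply: big1 => j _; rewrite /hess.
  rewrite Dc (der0 Dder) big1 ?subr0 ?mulr0 // => m _; by rewrite Dc mulr0.
by rewrite (lapM Dder half Gsym GGi) L0 D0; ring.
Qed.

Let lapD' := lapD Dder half G Gi.

(** f and - lambda s have the same differential, hence the same Laplacian, which is - lambda k f. *)
Lemma lap_mul_f u : Lap (f * u) = f * Lap u - lam * Z u.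
Proof.
have -> : Lap (f * u) = f * Lap u + u * Lap f + 2 * Dot u f.
  by rewrite (lapM Dder half Gsym GGi) (dotC D Gsym GGi f).
have -> : Lap f = - lam * Lap s.
  transitivity (Lap (- lam * s)); last first.
    by rewrite lap_const // => i; rewrite (derN Dder) Dlam oppr0.
  apply: eq_bigr => i _; apply: eq_bigr => j _; rewrite /hess.
  have Df m : D m f = D m (- lam * s).
    by rewrite der_f DM (derN Dder) Dlam; ring.
  by rewrite Df; congr (_ * (_ - _)); apply: eq_bigr => m _; rewrite Df.
by rewrite lap_s dot_f /commZ; ring.
Qed.

(** [Dot u s] is the derivative of u along the conformal field grad s. Replacing df by - lambda ds
    and 2 <du, ds> by Z u - k f u brings the result back to Z. *)
Lemma lap_commZ u :
  Lap (Z u) = Z (Lap u) + 4 * f * Lap u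
              - 2 * lam * Z u - lam * k%:R * (k%:R - 2) * f * u.
Proof.
have -> : Z u = 2 * Dot u s + k%:R * (f * u) by rewrite /commZ; ring.
have Dnat (m : nat) i : D i m%:R = 0 by exact: (der_nat Dder).
rewrite lapD' (lap_const _ (Dnat 2)) (lap_const _ (Dnat k)).
have -> : Lap (Dot u s) = Dot (Lap u) s + 2 * f * Lap u - (k%:R - 2) * Dot u f.
  have dE v : Dot v s = \sum_i Grad s i * D i v.
    by rewrite dotE; apply: eq_bigr => i _; rewrite mulrC.
  rewrite !dE; exact: (lap_conformal_field Dder halfE Gsym GGi grad_s).
by rewrite lap_mul_f dot_f /commZ; ring.
Qed.

Context (q : A).
Hypotheses (qE : q + q = k%:R) (Dq : forall i, D i q = 0).

Definition op_shift (j : nat) := (q + j%:R - 1) * (q - j%:R).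
Definition op_factor (j : nat) u := - Lap u + lam * op_shift j * u.
(** The factor of highest index acts first, so an induction peels off the factor next to the
    argument, where the operator Q_l arises. *)
Fixpoint op_prod (l : nat) u :=
  if l is l'.+1 then op_prod l' (op_factor l u) else u.

(** The operator Q_l. Its correction term is what remains when the factor of the second metric is
    conjugated by powers of s, see [op_factor_conformal]; for l = 0 it is absent. *)
Definition op_conj (l : nat) u :=
  s * op_factor l.+1 u + l%:R * (Z u - (2 * l%:R + 2) * f * u).

Let Z_lin c u v : (forall i, D i c = 0) -> Z (- u + c * v) = - Z u + c * Z v.
Proof.
move=> Dc; rewrite /commZ.
have -> : Dot (- u + c * v) s = - Dot u s + c * Dot v s.
  rewrite !dotE -sumrN mulr_sumr -big_split; apply: eq_bigr => i _ /=.
  by rewrite DD DM (derN Dder) Dc; ring.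
ring.
Qed.

Let Dop_shift j i : D i (op_shift j) = 0.
Proof.
by rewrite /op_shift DM !(DD, derN Dder) Dq (der_nat Dder) (der1 Dder); ring.
Qed.

Let lapN u : Lap (- u) = - Lap u.
Proof.
rewrite -[- u]mulN1r lap_const ?mulN1r // => i.
by rewrite (derN Dder) (der1 Dder) oppr0.
Qed.

(** Moving F past s, Z and f by the three commutators leaves multiples of Z u, f Delta u and f u.
    Their coefficients vanish once [op_shift j] is expanded as q^2 - q - j (j - 1) and k is replaced
    by 2 q. *)
Lemma op_factor_conj l u :
  op_factor l.+1 (op_conj l.+1 u) = op_conj l (op_factor l.+2 u).
Proof.
rewrite /op_conj /op_factor.
have Dls j i : D i (lam * op_shift j) = 0 by rewrite DM Dlam Dop_shift; ring.
have Dl2 i : D i (- (2 * l.+1%:R + 2)) = 0.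
  by rewrite (derN Dder) DD DM !(der_nat Dder); ring.
set m := (2 * l.+1%:R + 2) in Dl2 *; set F := - Lap u + _.
have lapF : Lap F = - Lap (Lap u) + lam * op_shift l.+2 * Lap u.
  by rewrite lapD' lapN lap_const.
have ZF : Z F = - Z (Lap u) + lam * op_shift l.+2 * Z u by rewrite Z_lin.
have lapQ : Lap (s * F + l.+1%:R * (Z u - m * f * u)) =
    s * Lap F + Z F + l.+1%:R * (Lap (Z u) + - m * (f * Lap u - lam * Z u)).
  have -> : Z u - m * f * u = Z u + (- m) * (f * u) by ring.
  rewrite lapD' lap_mul_s (lap_const _ (der_nat Dder ^~ l.+1)).
  rewrite [Lap (Z u + _)]lapD'.
  by rewrite (lap_const _ Dl2) lap_mul_f.
rewrite lapQ ZF lapF lap_commZ /F /m /op_shift -qE -!natr1; ring.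
Qed.

Lemma op_prod_conj l u : op_prod l (op_conj l u) = s * op_prod l (op_factor l.+1 u).
Proof.
elim: l u => [|l IHl] u; first by rewrite /= /op_conj mul0r addr0.
by rewrite /= op_factor_conj IHl.
Qed.

End Concircular.

(** * Conformal covariance of the product, by induction on the number of factors *)

Section Covariance.
Context (A : comPzRingType) (k : nat) (D : 'I_k -> A -> A).
Hypothesis Dder : commuting_derivations D.
Context (half : A).
Hypothesis halfE : half + half = 1.
Context (G Gi : 'M[A]_k).
Hypotheses (Gsym : G^T = G) (GGi : G *m Gi = 1%:M).
Context (om s E f lam lamh q : A).
Hypotheses (Dlam : forall i, D i lam = 0) (Dlamh : forall i, D i lamh = 0).
Hypotheses (qE : q + q = k%:R) (Dq : forall i, D i q = 0).
Hypothesis Es : E * s ^+ 2 = 1.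
Hypothesis Ds : forall i, D i s = - s * D i om.
Hypothesis DE : forall i, D i E = (D i om + D i om) * E.
Local Notation Lap := (lap D half G Gi).
Local Notation Dot := (dot D Gi).
Local Notation Hess := (hess D half G Gi).
Hypothesis hess_s : forall i j, Hess s i j = f * G i j.
Hypothesis fE : 2 * s * f = Dot s s - lam * s ^+ 2 + lamh.

Let DD i a b : D i (a + b) = D i a + D i b. Proof. by case: Dder. Qed.

(** [b] and [b'] stand for s^(l - k/2) and s^(l + 1 - k/2). Beyond the product rules two relations
    enter: [fE] eliminates lambdahat, and Delta s = k f eliminates Delta omega. *)
Lemma op_factor_conformal l b b' u :
    b' = s * b -> (forall i, D i b' = (q - l.+1%:R) * b' * D i om) ->
  b * op_factor D half (E *: G) (s ^+ 2 *: Gi) lamh q l.+1 u =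
  op_conj D half G Gi s f lam q l (b' * u).
Proof.
move=> bE Db; set t := q - l.+1%:R in Db.
have Dt i : D i t = 0 by rewrite DD (derN Dder) Dq (der_nat Dder) subrr.
have Dm1 i : D i (-1) = 0 by rewrite (derN Dder) (der1 Dder) oppr0.
have Ds' i : D i s = (-1) * s * D i om by rewrite Ds; ring.
rewrite /op_factor /op_conj /op_factor /commZ (lap_conformal Dder halfE Gsym GGi Es DE).
rewrite (lapM Dder half Gsym GGi) (dotMl Dder) (lap_exp Dder half G Gi Dt Db).
have eqs := lap_exp Dder half G Gi Dm1 Ds'.
rewrite (lap_s Gsym GGi hess_s) in eqs.
have d1 v : Dot v s = - s * Dot v om.
  by rewrite !(dotC D Gsym GGi v) (dot_exp Gi _ Ds'); ring.
have d2 v : Dot b' v = t * b' * Dot om v by exact: dot_exp.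
rewrite d2 !d1 d2 (dotC D Gsym GGi om u).
have lamhE : lamh = 2 * s * f - s ^+ 2 * Dot om om + lam * s ^+ 2.
  have -> : s ^+ 2 * Dot om om = Dot s s.
    by rewrite d1 (dotC D Gsym GGi) d1; ring.
  by rewrite fE; ring.
have e0 : s * Lap om = s * Dot om om - k%:R * f by rewrite eqs; ring.
(* Once lambdahat is substituted, the difference of the two sides is a multiple of the relation
   [e0]. *)
apply/eqP; rewrite -subr_eq0; apply/eqP.
transitivity (u * t * b' * (s * Lap om - (s * Dot om om - k%:R * f))); last first.
  by rewrite e0 subrr mulr0.
rewrite lamhE bE /t /op_shift -qE -natr1; ring.
Qed.

Let s_reg (half2 : 2 * half = 1) a : 2 * s * a = 0 -> a = 0.
Proof.
move=> e; have -> : a = half * E * s * (2 * s * a).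
  transitivity ((2 * half) * (E * s ^+ 2) * a); last by ring.
  by rewrite half2 Es mulr1 mul1r.
by rewrite e mulr0.
Qed.

(** [a l] and [b l] model e^((-k/2 - l) omega) and e^((k/2 - l) omega). Raising l multiplies both by
    s: for [b] this is absorbed by Q_l, and for [a] it is the s that [op_prod_conj] brings out. *)
Lemma op_prod_conformal (a b : nat -> A) u :
    a 0%N * b 0%N = 1 ->
    (forall l, a l.+1 = s * a l) -> (forall l, b l.+1 = s * b l) ->
    (forall l i, D i (b l) = (q - l%:R) * b l * D i om) ->
  forall l, op_prod D half (E *: G) (s ^+ 2 *: Gi) lamh q l u =
            a l * op_prod D half G Gi lam q l (b l * u).
Proof.
move=> ab0 aS bS Db l; elim: l u => [|l IHl] u.
  by rewrite /= mulrA ab0 mul1r.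
have half2 : 2 * half = 1 by rewrite mulr_natl mulr2n.
rewrite [LHS]/= IHl (op_factor_conformal u (bS l) (Db l.+1)).
rewrite (op_prod_conj Dder halfE Gsym GGi Dlam Dlamh (s_reg half2) hess_s fE qE Dq).
by rewrite /= aS; ring.
Qed.
End Covariance.

(** * Smooth functions on open subsets of R^n *)

Section LocalCalculus.
Context (R : realType).

(** Differentiability depends only on the germ. This matters because local expressions are total
    functions that are controlled only on an open set. *)
Lemma near_eq_differentiable (V W : normedModType R) (f g : V -> W) (x : V) :
  {near x, f =1 g} -> differentiable f x -> differentiable g x.
Proof.
move=> fg /diff_locallyP[dfc /eqaddoP dfE].
have gx : g x = f x by rewrite (nbhs_singleton fg).
have E : g \o shift x = cst (g x) + 'd f x +o_ 0 id.
  apply/eqaddoP => e e0; have := dfE e e0; apply: filter_app.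
  have : \forall h \near 0, f (h + x) = g (h + x).
    by move: fg; rewrite (near_shift 0) subr0.
  by apply: filter_app; near=> h => /= fgh; rewrite !fctE /= fgh gx.
by apply/diff_locallyP; rewrite (diff_unique dfc E).
Unshelve. all: by end_near. Qed.

End LocalCalculus.

Section Smooth.
Context (R : realType).

Section OneDimension.
Context (n : nat).
Implicit Types (U : set 'rV[R]_n) (f g : 'rV[R]_n -> R) (i j : 'I_n).

(** The last entry of the list is the innermost derivative, so both directions split the list at its
    end. *)
Lemma smooth_onP U f : smooth_on U f <->
  (forall x, U x -> differentiable f x) /\ forall i, smooth_on U (partial i f).
Proof.
split=> [sf|[df sf] s x Ux].
  split=> [x|i s x] Ux; first exact: (sf [::]).
  by have := sf (rcons s i) x Ux; rewrite foldr_rcons.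
elim/last_ind: s => [|s i _] /=; first exact: df.
by rewrite foldr_rcons; exact: sf.
Qed.

Lemma smooth_on_diff U f x : smooth_on U f -> U x -> differentiable f x.
Proof. by move=> sf; exact: (sf [::]). Qed.

Lemma smooth_on_partial U f i : smooth_on U f -> smooth_on U (partial i f).
Proof. by move=> /smooth_onP[]. Qed.

Lemma partial_congr U f g i : open U -> {in U, f =1 g} ->
  {in U, partial i f =1 partial i g}.
Proof.
move=> Uo fg x Ux; apply: near_eq_derive; near=> y; apply: fg.
rewrite inE; near: y; apply: open_nbhs_nbhs; split => //; exact: set_mem.
Unshelve. all: by end_near. Qed.

Lemma smooth_on_congr U f g : open U -> {in U, f =1 g} ->
  smooth_on U f -> smooth_on U g.
Proof.
move=> Uo fg sf s x Ux.
have E : {in U, foldr (@partial R n) f s =1 foldr (@partial R n) g s}.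
  by elim: s => [//|i s IHs] /=; exact: partial_congr.
apply: near_eq_differentiable (sf s x Ux); near=> y; apply: E.
rewrite inE; near: y; exact: open_nbhs_nbhs.
Unshelve. all: by end_near. Qed.

Lemma smooth_on_local U f :
    (forall x, U x -> exists2 V, open V /\ V x & smooth_on V f) ->
  smooth_on U f.
Proof. by move=> H s x /H[V [_ Vx] sf]; exact: sf. Qed.

(** Closure properties are proved one order of differentiation at a time. *)
Fixpoint diff_on (m : nat) U f : Prop :=
  (forall x, U x -> differentiable f x) /\
  if m is m'.+1 then forall i, diff_on m' U (partial i f) else True.

Lemma smooth_on_diffP U f : smooth_on U f <-> forall m, diff_on m U f.
Proof.
split=> [+ m|H s].
  elim: m f => [|m IHm] f /smooth_onP[df sf]; split => // i.
  exact/IHm/sf.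
have {H} : diff_on (size s) U f by [].
elim/last_ind: s f => [|s i IHs] f; first by case.
by rewrite size_rcons foldr_rcons /= => -[_ /(_ i)/IHs].
Qed.

Lemma diff_on_le m p U f : (p <= m)%N -> diff_on m U f -> diff_on p U f.
Proof.
elim: m p f => [|m IHm] [|p] f //= pm [df H]; split => // i.
exact: IHm (H i).
Qed.

Lemma diff_on_congr m U f g : open U -> {in U, f =1 g} ->
  diff_on m U f -> diff_on m U g.
Proof.
move=> Uo fg.
have dg h k : {in U, h =1 k} -> (forall x, U x -> differentiable h x) ->
    forall x, U x -> differentiable k x.
  move=> hk dh x Ux; apply: near_eq_differentiable (dh x Ux); near=> y; apply: hk.
  by rewrite inE; near: y; exact: open_nbhs_nbhs.
elim: m f g fg => [|m IHm] f g fg [df H]; split=> //; try exact: dg df.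
by move=> i; apply: IHm (H i); exact: partial_congr.
Unshelve. all: by end_near. Qed.

Lemma partialD f g i x : differentiable f x -> differentiable g x ->
  partial i (f \+ g) x = partial i f x + partial i g x.
Proof.
by move=> df dg; rewrite /partial deriveD //; exact: diff_derivable.
Qed.

Lemma partialM f g i x : differentiable f x -> differentiable g x ->
  partial i (f \* g) x = partial i f x * g x + f x * partial i g x.
Proof.
move=> df dg; rewrite /partial deriveM; [|exact: diff_derivable..].
by rewrite addrC; congr (_ + _); exact: mulrC.
Qed.

Lemma partial_cst (a : R) i x : partial i (cst a) x = 0.
Proof. exact: derive_cst. Qed.

Lemma partial_comp1 (phi : R -> R) f i x : derivable phi (f x) 1 ->
  differentiable f x ->
  partial i (phi \o f) x = 'D_1 phi (f x) * partial i f x.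
Proof.
move=> /derivable1_diffP dphi df.
rewrite /partial deriveE; last exact: differentiable_comp.
rewrite diff_comp //= [in RHS]deriveE // [in RHS]deriveE //.
by rewrite -[X in 'd _ _ X = _]mulr1 [LHS]linearZ mulrC.
Qed.

Lemma diff_on_cst m U (a : R) : diff_on m U (cst a).
Proof.
elim: m a => [|m IHm] a /=; split => // i.
by rewrite (_ : partial i (cst a) = cst 0) //; apply/funext => x; rewrite partial_cst.
Qed.

Lemma diff_onD m U f g : open U -> diff_on m U f -> diff_on m U g ->
  diff_on m U (f \+ g).
Proof.
move=> Uo; elim: m f g => [|m IHm] f g [df Hf] [dg Hg]; split => //=.
- by move=> x Ux; apply: differentiableD; [exact: df|exact: dg].
- by move=> x Ux; apply: differentiableD; [exact: df|exact: dg].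
move=> i; apply: diff_on_congr (IHm _ _ (Hf i) (Hg i)) => // x.
by rewrite inE => Ux; rewrite partialD //; [exact: df|exact: dg].
Qed.

Lemma diff_onM m U f g : open U -> diff_on m U f -> diff_on m U g ->
  diff_on m U (f \* g).
Proof.
move=> Uo; elim: m f g => [|m IHm] f g Hf Hg.
  by case: Hf Hg => df _ [dg _]; split => // x Ux; apply: differentiableM; [exact: df|exact: dg].
have [[df Hf'] [dg Hg']] := (Hf, Hg).
split=> [x Ux|i]; first by apply: differentiableM; [exact: df|exact: dg].
have Hf0 := diff_on_le (leqnSn m) Hf; have Hg0 := diff_on_le (leqnSn m) Hg.
apply: diff_on_congr (diff_onD Uo (IHm _ _ (Hf' i) Hg0) (IHm _ _ Hf0 (Hg' i))) => //.
by move=> x; rewrite inE => Ux; rewrite partialM //; [exact: df|exact: dg].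
Qed.

(** The derivative - f' / f^2 contains the reciprocal again, but one order lower, where the
    induction supplies it. The exponential is treated in the same way. *)
Lemma diff_onV m U f : open U -> (forall x, U x -> f x != 0) ->
  diff_on m U f -> diff_on m U (fun x => (f x)^-1).
Proof.
move=> Uo f0; elim: m => [|m IHm] Hf.
  by case: Hf => df _; split => // x Ux; apply: differentiableV; [exact: df|exact: f0].
have [df Hf'] := Hf; have Hf0 := diff_on_le (leqnSn m) Hf.
split=> [x Ux|i]; first by apply: differentiableV; [exact: df|exact: f0].
have H := diff_onM Uo (diff_onM Uo (diff_on_cst m U (-1)) (Hf' i))
  (diff_onM Uo (IHm Hf0) (IHm Hf0)).
apply: diff_on_congr H => // x; rewrite inE => Ux /=.
rewrite /partial deriveV; [|exact: f0|exact/diff_derivable/df].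
by rewrite mulN1r mulrC mulrN expr2 invfM -mulNr.
Qed.

Lemma diff_on_expR m U f : open U ->
  diff_on m U f -> diff_on m U (fun x => expR (f x)).
Proof.
move=> Uo; elim: m => [|m IHm] Hf.
  case: Hf => df _; split => // x Ux; apply: differentiable_comp; first exact: df.
  exact/derivable1_diffP/derivable_expR.
have [df Hf'] := Hf; have Hf0 := diff_on_le (leqnSn m) Hf.
split=> [x Ux|i].
  apply: differentiable_comp; first exact: df.
  exact/derivable1_diffP/derivable_expR.
apply: diff_on_congr (diff_onM Uo (IHm Hf0) (Hf' i)) => // x; rewrite inE => Ux /=.
rewrite [RHS]partial_comp1; [|exact: derivable_expR|exact: df].
by congr (_ * _); rewrite derive_val.
Qed.

Lemma diff_on_sum m U (I : Type) (r : seq I) (F : I -> 'rV[R]_n -> R) : open U ->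
  (forall l, diff_on m U (F l)) -> diff_on m U (fun x => \sum_(l <- r) F l x).
Proof.
move=> Uo HF; elim: r => [|l r IHr].
  rewrite (_ : (fun _ => _) = cst 0); first exact: diff_on_cst.
  by apply/funext => x; rewrite big_nil.
rewrite (_ : (fun _ => _) = F l \+ fun x => \sum_(l <- r) F l x).
  exact: diff_onD.
by apply/funext => x; rewrite big_cons.
Qed.

Lemma smooth_on_cst U (a : R) : smooth_on U (cst a).
Proof. by apply/smooth_on_diffP => m; exact: diff_on_cst. Qed.

Lemma smooth_onD U f g : open U -> smooth_on U f -> smooth_on U g ->
  smooth_on U (f \+ g).
Proof.
move=> Uo /smooth_on_diffP Hf /smooth_on_diffP Hg; apply/smooth_on_diffP => m.
exact: diff_onD.
Qed.

Lemma smooth_onM U f g : open U -> smooth_on U f -> smooth_on U g ->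
  smooth_on U (f \* g).
Proof.
move=> Uo /smooth_on_diffP Hf /smooth_on_diffP Hg; apply/smooth_on_diffP => m.
exact: diff_onM.
Qed.

Lemma smooth_onV U f : open U -> (forall x, U x -> f x != 0) ->
  smooth_on U f -> smooth_on U (fun x => (f x)^-1).
Proof.
move=> Uo f0 /smooth_on_diffP Hf; apply/smooth_on_diffP => m.
exact: diff_onV.
Qed.

Lemma smooth_on_expR U f : open U ->
  smooth_on U f -> smooth_on U (fun x => expR (f x)).
Proof.
move=> Uo /smooth_on_diffP Hf; apply/smooth_on_diffP => m.
exact: diff_on_expR.
Qed.

Lemma is_derive_line f (a v : 'rV[R]_n) (s : R) : derivable f (a + s *: v) v ->
  is_derive s 1 (fun t => f (a + t *: v)) ('D_v f (a + s *: v)).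
Proof.
move=> df.
have E : (fun h : R => h^-1 *: (f (a + (h *: (1 : R) + s) *: v) - f (a + s *: v))) =
         (fun h : R => h^-1 *: (f (h *: v + (a + s *: v)) - f (a + s *: v))).
  apply/funext => h; congr (_ *: (f _ - _)).
  by rewrite scalerDl [h *: (1 : R)]mulr1 addrCA.
by apply: DeriveDef; rewrite /derivable /derive /= E.
Qed.

Lemma mvt_line f (a v : 'rV[R]_n) (h : R) : 0 < h ->
    (forall t, 0 <= t <= h -> differentiable f (a + t *: v)) ->
  exists2 s, 0 < s < h & f (a + h *: v) - f a = h * 'D_v f (a + s *: v).
Proof.
move=> h0 df; have D t : 0 <= t <= h ->
    is_derive t 1 (fun t => f (a + t *: v)) ('D_v f (a + t *: v)).
  by move=> th; apply: is_derive_line; exact/diff_derivable/df.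
have [||c] := @MVT R (fun t => f (a + t *: v)) (fun t => 'D_v f (a + t *: v)) 0 h h0.
- by move=> t; rewrite in_itv /= => /andP[t0 th]; apply: D; rewrite !ltW.
- apply: derivable_within_continuous => t; rewrite in_itv /= => /D dt.
  exact: ex_derive.
rewrite in_itv /= => ch; rewrite subr0 scale0r addr0 => E.
by exists c => //; rewrite mulrC -E.
Qed.

(** The mean value theorem for the difference of [f] along two parallel segments. A further use of
    [mvt_line] in the direction [w] turns a second difference into a mixed derivative. *)
Lemma line_mvt f (a v w : 'rV[R]_n) (h : R) : 0 < h ->
    (forall t, 0 <= t <= h -> differentiable f (a + t *: v + w) /\
                              differentiable f (a + t *: v)) ->
  exists2 s, 0 < s < h &
    (f (a + h *: v + w) - f (a + h *: v)) - (f (a + w) - f a) =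
    h * ('D_v f (a + s *: v + w) - 'D_v f (a + s *: v)).
Proof.
move=> h0 df.
pose phi t := f (a + w + t *: v) - f (a + t *: v).
pose dphi t := 'D_v f (a + w + t *: v) - 'D_v f (a + t *: v).
have D t : 0 <= t <= h -> is_derive t 1 phi (dphi t).
  move=> /df[d1 d2]; apply: is_deriveB; apply: is_derive_line;
    apply: diff_derivable => //; by rewrite addrAC.
have [||c] := @MVT R phi dphi 0 h h0.
- by move=> t; rewrite in_itv /= => /andP[t0 th]; apply: D; rewrite !ltW.
- apply: derivable_within_continuous => t; rewrite in_itv /= => /D dt.
  exact: ex_derive.
rewrite in_itv /= => ch; rewrite subr0 /phi /dphi => E; exists c => //.
rewrite mulrC !(addrAC a _ w) -E !scale0r !addr0; ring.
Qed.

End OneDimension.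

(** * The chain rule and composition of smooth maps *)

Section Composition.
Context (k n : nat).
Implicit Types (U : set 'rV[R]_k) (V : set 'rV[R]_n) (F : 'rV[R]_k -> 'rV[R]_n).

Lemma differentiable_row F x : (forall j, differentiable (fun y => F y 0 j) x) ->
  differentiable F x.
Proof.
move=> dF.
have -> : F = \sum_(j < n) (fun y => F y 0 j *: (delta_mx 0 j : 'rV[R]_n)).
  by apply/funext => y; rewrite fct_sumE [LHS]row_sum_delta.
by apply: differentiable_sum => j; exact: differentiableZl.
Qed.

Lemma partial_comp (phi : 'rV[R]_n -> R) F a y :
    differentiable phi (F y) -> (forall j, differentiable (fun z => F z 0 j) y) ->
  partial a (phi \o F) y =
  \sum_i partial i phi (F y) * partial a (fun z => F z 0 i) y.
Proof.
move=> dphi dF; have dF' := differentiable_row dF.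
rewrite /partial deriveE; last exact: differentiable_comp.
rewrite diff_comp //=.
have -> : 'd F y (delta_mx 0 a) =
    \row_i partial a (fun z => F z 0 i) y.
  rewrite -deriveE //; apply/rowP => i; rewrite derive_mx ?mxE //.
  exact: diff_derivable.
rewrite [X in 'd _ _ X]row_sum_delta linear_sum; apply: eq_bigr => i _.
by rewrite linearZ /= mxE [RHS]mulrC [X in _ = _ * X]deriveE.
Qed.

Lemma diff_on_comp m U V (phi : 'rV[R]_n -> R) F : open U -> open V ->
    (forall y, U y -> V (F y)) -> (forall j, diff_on m U (fun y => F y 0 j)) ->
  diff_on m V phi -> diff_on m U (phi \o F).
Proof.
move=> Uo Vo UV; elim: m phi => [|m IHm] phi HF Hphi.
  case: Hphi => dphi _; split => // y Uy; apply: differentiable_comp.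
    by apply: differentiable_row => j; have [+ _] := HF j; apply.
  exact/dphi/UV.
have [dphi Hphi'] := Hphi.
have dF y j : U y -> differentiable (fun z => F z 0 j) y.
  by have [+ _] := HF j; apply.
split=> [y Uy|a].
  apply: differentiable_comp; first by apply: differentiable_row => j; exact: dF.
  exact/dphi/UV.
have HF0 j : diff_on m U (fun y => F y 0 j) by exact: diff_on_le (leqnSn m) (HF j).
have H i : diff_on m U ((partial i phi \o F) \* partial a (fun z => F z 0 i)).
  by apply: diff_onM => //; [exact: IHm (Hphi' i)|case: (HF i) => _; apply].
apply: diff_on_congr (diff_on_sum (index_enum _) Uo H) => // y; rewrite inE => Uy /=.
rewrite [RHS]partial_comp //; first exact/dphi/UV.
by move=> j; exact: dF.
Qed.

Lemma smooth_on_comp U V (phi : 'rV[R]_n -> R) F : open U -> open V ->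
    (forall y, U y -> V (F y)) -> vsmooth_on U F ->
  smooth_on V phi -> smooth_on U (phi \o F).
Proof.
move=> Uo Vo UV HF /smooth_on_diffP Hphi; apply/smooth_on_diffP => m.
by apply: diff_on_comp Uo Vo UV _ (Hphi m) => j; have /smooth_on_diffP := HF j; apply.
Qed.

End Composition.
End Smooth.

(** * Symmetry of second partial derivatives *)

Section Schwarz.
Context (R : realType) (n : nat).
Implicit Types (U : set 'rV[R]_n) (f g : 'rV[R]_n -> R) (i j : 'I_n).

Let ler_distD_half (a b c e : R) :
  `|a - c| <= e / 2 -> `|b - c| <= e / 2 -> `|a - b| <= e.
Proof.
by rewrite !ler_norml => /andP[? ?] /andP[? ?]; apply/andP; split; lra.
Qed.

(** Schwarz: both mixed partials are limits of the same second difference. *)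
Lemma partialC U f i j x : open U -> smooth_on U f -> U x ->
  partial i (partial j f) x = partial j (partial i f) x.
Proof.
move=> Uo sf Ux; apply/eqP; rewrite -subr_eq0 -normr_le0; apply/ler_addgt0Pl => e e0; rewrite addr0.
pose ei : 'rV[R]_n := delta_mx 0 i; pose ej : 'rV[R]_n := delta_mx 0 j.
have c1 : {for x, continuous (partial i (partial j f))}.
  apply: differentiable_continuous; apply: (smooth_on_diff _ Ux).
  by do 2!apply: smooth_on_partial.
have c2 : {for x, continuous (partial j (partial i f))}.
  apply: differentiable_continuous; apply: (smooth_on_diff _ Ux).
  by do 2!apply: smooth_on_partial.
have e2 : 0 < e / 2 by rewrite divr_gt0.
have [d /= d0 Hd] : exists2 d : R, 0 < d & forall y, ball x d y ->
   [/\ U y, `|partial i (partial j f) x - partial i (partial j f) y| <= e / 2 &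
        `|partial j (partial i f) x - partial j (partial i f) y| <= e / 2].
  have n0 : nbhs x U by exact: open_nbhs_nbhs.
  have n1 : nbhs x [set y |
      `|partial i (partial j f) x - partial i (partial j f) y| <= e / 2].
    exact: ((cvgrPdist_le _ _).1 c1 _ e2).
  have n2 : nbhs x [set y |
      `|partial j (partial i f) x - partial j (partial i f) y| <= e / 2].
    exact: ((cvgrPdist_le _ _).1 c2 _ e2).
  have /nbhs_ballP[d0 /= d00 H0] := n0.
  have /nbhs_ballP[d1 /= d10 H1] := n1.
  have /nbhs_ballP[d2 /= d20 H2] := n2.
  exists (Num.min d0 (Num.min d1 d2)); first by rewrite !lt_min d00 d10 d20.
  move=> y xy; split; [apply: H0|apply: H1|apply: H2];
    by apply: le_ball xy; rewrite !ge_min lexx ?orbT.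
(* Two displacements of length at most d / 4 along basis vectors of norm at most 1 stay within the
   ball of radius d. *)
pose h := d / 4.
have h0 : 0 < h by rewrite divr_gt0.
have nei l : `|(delta_mx 0 l : 'rV[R]_n)| <= 1.
  rewrite [leLHS]/Num.Def.normr /= mx_normrE; apply: bigmax_le => // -[a b] _.
  by rewrite mxE; case: (_ && _); rewrite ?normr0 ?normr1.
have Hb s t : 0 <= s <= h -> 0 <= t <= h -> ball x d (x + s *: ei + t *: ej).
  move=> /andP[s0 sh] /andP[t0 th]; rewrite -ball_normE /=.
  rewrite -addrA opprD addNKr normrN (le_lt_trans (ler_normD _ _)) //.
  rewrite !normrZ !ger0_norm //.
  have h1 : s * `|ei| <= h by have := ler_pM s0 (normr_ge0 ei) sh (nei i); rewrite mulr1.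
  have h2 : t * `|ej| <= h by have := ler_pM t0 (normr_ge0 ej) th (nei j); rewrite mulr1.
  by move: h1 h2; rewrite /h; lra.
have Hb' s t : 0 <= s <= h -> 0 <= t <= h -> ball x d (x + t *: ej + s *: ei).
  by move=> sh th; rewrite addrAC; exact: Hb.
have hh : 0 <= h <= h by rewrite ltW //=.
have h00 : 0 <= (0 : R) <= h by rewrite lexx ltW.
have dfy g s t : smooth_on U g -> 0 <= s <= h -> 0 <= t <= h ->
    differentiable g (x + s *: ei + t *: ej).
  by move=> sg sh th; apply: (smooth_on_diff sg); have [] := Hd _ (Hb s t sh th).
have dfy1 g s : smooth_on U g -> 0 <= s <= h -> differentiable g (x + s *: ei).
  by move=> sg sh; have := dfy g s 0 sg sh h00; rewrite scale0r addr0.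
have dfy2 g t : smooth_on U g -> 0 <= t <= h -> differentiable g (x + t *: ej).
  by move=> sg th; have := dfy g 0 t sg h00 th; rewrite scale0r addr0.
have wk s : 0 < s < h -> 0 <= s <= h by move=> /andP[? ?]; rewrite !ltW.
have si := smooth_on_partial i sf; have sj := smooth_on_partial j sf.
have [|s1 s1h E1] := @line_mvt R n f x ei (h *: ej) h h0.
  by move=> t th; split; [exact: dfy|exact: dfy1].
have [|t1 t1h F1] := mvt_line (f := partial i f) (a := x + s1 *: ei) (v := ej) h0.
  by move=> t th; apply: dfy => //; exact: wk.
have [|t2 t2h E2] := @line_mvt R n f x ej (h *: ei) h h0.
  by move=> t th; split; [rewrite addrAC; exact: dfy|exact: dfy2].
have [|s2 s2h F2] := mvt_line (f := partial j f) (a := x + t2 *: ej) (v := ei) h0.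
  by move=> t th; rewrite addrAC; apply: dfy => //; exact: wk.
(* The second difference over the square of side h, computed in both orders, is h^2 times either of
   these values. *)
have EQ : partial j (partial i f) (x + s1 *: ei + t1 *: ej) =
          partial i (partial j f) (x + t2 *: ej + s2 *: ei).
  suff EQ2 : h * (h * partial j (partial i f) (x + s1 *: ei + t1 *: ej)) =
             h * (h * partial i (partial j f) (x + t2 *: ej + s2 *: ei)).
    exact: (mulfI (lt0r_neq0 h0) (mulfI (lt0r_neq0 h0) EQ2)).
  have E1' := etrans E1 (congr1 ( *%R h) F1).
  have E2' := etrans E2 (congr1 ( *%R h) F2).
  apply: etrans (esym E1') (etrans _ E2').
  rewrite [x + h *: ej + _]addrAC.
  by rewrite !opprB addrACA [RHS]addrACA; congr (_ + _); exact: addrC.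
have [_ _ B1] := Hd _ (Hb s1 t1 (wk _ s1h) (wk _ t1h)).
have [_ B2 _] := Hd _ (Hb' s2 t2 (wk _ s2h) (wk _ t2h)).
have B1' := eq_ind _ (fun z => `|partial j (partial i f) x - z| <= e / 2) B1 _ EQ.
exact: ler_distD_half B2 B1'.
Qed.

End Schwarz.

(** * Local Riemannian geometry in rings of smooth functions *)

(** The commutative ring of smooth functions on an open set [U], represented by
    their extensions by zero, so that equality is equality on [U]. *)
Record smfun (R : realType) (n : nat) (U : set 'rV[R]_n) (Uo : open U) := SMFun {
  smfun_val :> 'rV[R]_n -> R ;
  smfun_smooth : smooth_on U smfun_val ;
  smfun_out : forall x, ~ U x -> smfun_val x = 0
}.

Section SmoothRing.
Context (R : realType) (n : nat) (U : set 'rV[R]_n) (Uo : open U).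
Local Notation smfun := (smfun Uo).
Implicit Types (f g : smfun) (i j : 'I_n).

HB.instance Definition _ := gen_eqMixin smfun.
HB.instance Definition _ := gen_choiceMixin smfun.

Lemma smfunP f g : (forall x, U x -> f x = g x) -> f = g.
Proof.
case: f g => [f sf f0] [g sg g0] /= fg.
have {}fg : f = g.
  by apply/funext => x; have [/fg//|nUx] := pselect (U x); rewrite f0 // g0.
case: g / fg sg g0 => sg g0.
by congr SMFun; exact: Prop_irrelevance.
Qed.

Let mk_smooth (f : 'rV[R]_n -> R) : smooth_on U f -> smooth_on U (f \_ U).
Proof. by apply: smooth_on_congr => // x Ux; rewrite patchE Ux. Qed.

Let mk_out (f : 'rV[R]_n -> R) x : ~ U x -> (f \_ U) x = 0.
Proof. by move=> nUx; rewrite patchN // notin_setE. Qed.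

Definition mk_smfun (f : 'rV[R]_n -> R) (sf : smooth_on U f) : smfun :=
  SMFun Uo (mk_smooth sf) (@mk_out f).

Lemma mk_smfunE (f : 'rV[R]_n -> R) (sf : smooth_on U f) x :
  U x -> mk_smfun sf x = f x.
Proof. by move=> Ux; rewrite /= patchT // inE. Qed.

Definition scst (a : R) := mk_smfun (@smooth_on_cst R n U a).

Let add f g := mk_smfun (smooth_onD Uo (smfun_smooth f) (smfun_smooth g)).
Let mul f g := mk_smfun (smooth_onM Uo (smfun_smooth f) (smfun_smooth g)).
Let opp f := mul (scst (-1)) f.

Let addE f g x : U x -> add f g x = f x + g x. Proof. exact: mk_smfunE. Qed.
Let mulE f g x : U x -> mul f g x = f x * g x. Proof. exact: mk_smfunE. Qed.
Let cstE a x : U x -> scst a x = a. Proof. exact: mk_smfunE. Qed.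

Let addA : associative add.
Proof. by move=> f g h; apply: smfunP => x Ux; rewrite !addE // addrA. Qed.
Let addC : commutative add.
Proof. by move=> f g; apply: smfunP => x Ux; rewrite !addE // addrC. Qed.
Let add0 : left_id (scst 0) add.
Proof. by move=> f; apply: smfunP => x Ux; rewrite addE // cstE // add0r. Qed.
Let addN : left_inverse (scst 0) opp add.
Proof.
move=> f; apply: smfunP => x Ux.
by rewrite addE // mulE // !cstE // mulN1r addNr.
Qed.
HB.instance Definition _ := GRing.isZmodule.Build smfun addA addC add0 addN.

Let mulA : associative mul.
Proof. by move=> f g h; apply: smfunP => x Ux; rewrite !mulE // mulrA. Qed.
Let mulC : commutative mul.
Proof. by move=> f g; apply: smfunP => x Ux; rewrite !mulE // mulrC. Qed.
Let mul1 : left_id (scst 1) mul.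
Proof. by move=> f; apply: smfunP => x Ux; rewrite mulE // cstE // mul1r. Qed.
Let mulD : left_distributive mul add.
Proof.
by move=> f g h; apply: smfunP => x Ux; rewrite addE // !mulE // addE // mulrDl.
Qed.
HB.instance Definition _ := GRing.Zmodule_isComPzRing.Build smfun mulA mulC mul1 mulD.

(** The proof of [U x] is an argument because evaluation is a ring morphism only at points of [U]:
    outside, the unit takes the value 0. *)
Definition sev x of U x := fun f => f x.

Lemma sev_inj f g : (forall x (Ux : U x), sev Ux f = sev Ux g) -> f = g.
Proof. by move=> fg; apply: smfunP => x Ux; exact: fg. Qed.

Section Evaluation.
Context (x : 'rV[R]_n) (Ux : U x).

Let sev_zmod : zmod_morphism (sev Ux).
Proof.
move=> f g; rewrite /sev addE // [X in _ + X]mulE //.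
by rewrite cstE // mulN1r.
Qed.
HB.instance Definition _ := GRing.isZmodMorphism.Build smfun R (sev Ux) sev_zmod.

Let sev_monoid : monoid_morphism (sev Ux).
Proof. by split=> [|f g]; rewrite /sev ?mulE // cstE. Qed.
HB.instance Definition _ := GRing.isMonoidMorphism.Build smfun R (sev Ux) sev_monoid.

Lemma sev0 : sev Ux 0 = 0. Proof. exact: rmorph0. Qed.
Lemma sev1 : sev Ux 1 = 1. Proof. exact: rmorph1. Qed.
Lemma sevD f g : sev Ux (f + g) = sev Ux f + sev Ux g. Proof. exact: rmorphD. Qed.
Lemma sevN f : sev Ux (- f) = - sev Ux f. Proof. exact: rmorphN. Qed.
Lemma sevM f g : sev Ux (f * g) = sev Ux f * sev Ux g. Proof. exact: rmorphM. Qed.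
Lemma sevX f m : sev Ux (f ^+ m) = sev Ux f ^+ m. Proof. exact: rmorphXn. Qed.
Lemma sev_nat m : sev Ux m%:R = m%:R. Proof. exact: rmorph_nat. Qed.
Lemma sev_sum (I : Type) (r : seq I) (P : pred I) (F : I -> smfun) :
  sev Ux (\sum_(l <- r | P l) F l) = \sum_(l <- r | P l) sev Ux (F l).
Proof. exact: rmorph_sum. Qed.

Lemma sev_mk (f : 'rV[R]_n -> R) (sf : smooth_on U f) : sev Ux (mk_smfun sf) = f x.
Proof. exact: mk_smfunE. Qed.

Lemma sev_cst a : sev Ux (scst a) = a.
Proof. exact: sev_mk. Qed.

End Evaluation.

Definition sder i f := mk_smfun (smooth_on_partial i (smfun_smooth f)).

Lemma sev_der x (Ux : U x) i f : sev Ux (sder i f) = partial i f x.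
Proof. exact: sev_mk. Qed.

Lemma partial_mk (f : 'rV[R]_n -> R) (sf : smooth_on U f) i x : U x ->
  partial i (mk_smfun sf) x = partial i f x.
Proof.
move=> Ux; apply: (partial_congr _ Uo); last by rewrite inE.
by move=> y; rewrite inE => Uy; exact: mk_smfunE.
Qed.

Lemma sev_der_mk (f : 'rV[R]_n -> R) (sf : smooth_on U f) i x (Ux : U x) :
  sev Ux (sder i (mk_smfun sf)) = partial i f x.
Proof. by rewrite sev_der partial_mk. Qed.

Lemma sev_der_eq (f : 'rV[R]_n -> R) (g : smfun) i x (Ux : U x) :
  (forall y (Uy : U y), sev Uy g = f y) -> sev Ux (sder i g) = partial i f x.
Proof.
move=> gf; rewrite sev_der; apply: (partial_congr _ Uo); last by rewrite inE.
by move=> y; rewrite inE => Uy; exact: gf.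
Qed.

Lemma sder_commuting : commuting_derivations sder.
Proof.
have df f x : U x -> differentiable f x by move=> Ux; exact: smooth_on_diff (smfun_smooth f) Ux.
split=> [i f g|i f g|i j f]; apply: sev_inj => x Ux.
- rewrite (@sev_der_eq (f \+ g)); last by move=> y Uy; exact: sevD.
  rewrite sevD !sev_der; exact: partialD (df f x Ux) (df g x Ux).
- rewrite (@sev_der_eq (f \* g)); last by move=> y Uy; exact: sevM.
  rewrite sevD !sevM !sev_der; exact: partialM (df f x Ux) (df g x Ux).
have E l l' : sev Ux (sder l (sder l' f)) = partial l (partial l' f) x.
  by apply: sev_der_eq => y Uy; exact: sev_der.
rewrite [LHS]E [RHS]E; exact: (partialC i j Uo (smfun_smooth f) Ux).
Qed.

Lemma sder_cst i a : sder i (scst a) = 0.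
Proof. by apply: sev_inj => x Ux; rewrite sev_der_mk partial_cst sev0. Qed.

End SmoothRing.

Arguments mk_smfun {R n U} Uo {f} sf.
Arguments scst {R n U} Uo a.
Arguments sder {R n U} Uo i f.

Lemma pos_unitmx (R : realType) (n : nat) (A : 'M[R]_n) :
  (forall v : 'rV[R]_n, v != 0 -> 0 < (v *m A *m v^T) 0 0) -> A \in unitmx.
Proof.
move=> Apos; rewrite -row_free_unit -kermx_eq0; apply/eqP/row_matrixP => i.
rewrite row0; apply/eqP; apply: contraT => ker0.
have := Apos _ ker0.
by rewrite (_ : row i (kermx A) *m A = 0) ?mul0mx ?mxE ?ltxx // -row_mul mulmx_ker row0.
Qed.

Definition represents (R : realType) (n : nat) (U : set 'rV[R]_n) (Uo : open U)
    (A : 'M[smfun Uo]_n) (G : 'rV[R]_n -> 'M[R]_n) : Prop :=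
  forall x (Ux : U x) i j, sev Ux (A i j) = G x i j.

(** The inverse is built from the adjugate and the reciprocal of the determinant, which makes the
    smoothness of its entries visible; it is then identified with [invmx] point by point. *)
Lemma represents_metric (R : realType) (n : nat) (U : set 'rV[R]_n) (Uo : open U)
    (G : 'rV[R]_n -> 'M[R]_n) :
    (forall i j, smooth_on U (fun x => G x i j)) ->
    (forall x, U x -> G x \in unitmx) ->
  exists A Ai : 'M[smfun Uo]_n, [/\ represents A G,
    represents Ai (fun x => invmx (G x)) & A *m Ai = 1%:M].
Proof.
move=> G_smooth GU; pose A := \matrix_(i, j) mk_smfun Uo (G_smooth i j).
have mapA x (Ux : U x) : map_mx (sev Ux) A = G x.
  by apply/matrixP => i j; rewrite !mxE sev_mk.
have det_neq0 x : U x -> \det A x != 0.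
  move=> Ux; have -> : \det A x = \det (G x) by rewrite -(mapA _ Ux) det_map_mx.
  by rewrite -unitfE -unitmxE GU.
pose idet : smfun Uo := mk_smfun Uo (smooth_onV Uo det_neq0 (smfun_smooth (\det A))).
have idetE : \det A * idet = 1.
  by apply: sev_inj => x Ux; rewrite sevM sev_mk sev1 /sev divff // det_neq0.
have AAi : A *m (idet *: \adj A) = 1%:M.
  by rewrite -scalemxAr mul_mx_adj scale_scalar_mx mulrC idetE.
exists A, (idet *: \adj A); split=> // x Ux i j; first by rewrite -(mapA _ Ux) [RHS]mxE.
have <- : map_mx (sev Ux) (idet *: \adj A) = invmx (G x); last by rewrite [RHS]mxE.
rewrite -[LHS]mul1mx -(mulVmx (GU _ Ux)) -mulmxA -{2}(mapA _ Ux) -map_mxM AAi.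
by rewrite map_mx1 mulmx1.
Qed.

Section LocalMetric.
Context (R : realType) (n : nat) (U : set 'rV[R]_n) (Uo : open U).
Context (G : 'rV[R]_n -> 'M[R]_n).
Local Notation smfun := (smfun Uo).
Context (A Ai : 'M[smfun]_n).
Hypotheses (AG : represents A G) (AiG : represents Ai (fun x => invmx (G x))).

Lemma represents_sym : (forall x, U x -> (G x)^T = G x) -> A^T = A.
Proof.
move=> Gs; apply/matrixP => i j; rewrite mxE; apply: sev_inj => x Ux.
by rewrite !AG -{1}(Gs _ Ux) mxE.
Qed.

Definition shalf : smfun := scst Uo 2^-1.

Lemma shalfE : shalf + shalf = 1.
Proof. by apply: sev_inj => x Ux; rewrite sevD sev_cst sev1 -[2^-1]mul1r -splitr. Qed.

Local Notation D := (sder Uo).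
Local Notation sGa := (chr D shalf A Ai).

Lemma sev_chr x (Ux : U x) m i j : sev Ux (sGa m i j) = christoffel G m i j x.
Proof.
rewrite sev_sum /christoffel mulr_sumr; apply: eq_bigr => l _.
have E a b c : sev Ux (D a (A b c)) = partial a (fun y => G y b c) x.
  by apply: sev_der_eq => y Uy; rewrite AG.
rewrite !sevM AiG sevD sevN sevD sev_cst !E; ring.
Qed.

Lemma sev_ric x (Ux : U x) i j : sev Ux (ric D sGa i j) = ricci G i j x.
Proof.
have E a b c d : sev Ux (D a (sGa b c d)) = partial a (christoffel G b c d) x.
  by apply: sev_der_eq => y Uy; rewrite sev_chr.
rewrite sev_sum; apply: eq_bigr => r _.
rewrite sevD sevD sevN sev_sum; congr (_ - _ + _); try exact: E.
apply: eq_bigr => l _; rewrite sevD sevN.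
congr (_ - _); apply: etrans (sevM _ _ _) _; congr (_ * _); exact: sev_chr.
Qed.

Definition local_hess (u : 'rV[R]_n -> R) (i j : 'I_n) (x : 'rV[R]_n) :=
  partial i (partial j u) x - \sum_m christoffel G m i j x * partial m u x.

Lemma sev_hess x (Ux : U x) (u : smfun) (v : 'rV[R]_n -> R) i j :
    (forall y (Uy : U y), sev Uy u = v y) ->
  sev Ux (hess D shalf A Ai u i j) = local_hess v i j x.
Proof.
move=> uv; have E m y (Uy : U y) : sev Uy (D m u) = partial m v y.
  exact: sev_der_eq.
rewrite sevD sevN sev_sum; congr (_ - _).
  by apply: sev_der_eq => y Uy; exact: E.
by apply: eq_bigr => m _; rewrite sevM sev_chr E.
Qed.

Lemma sev_lap x (Ux : U x) (u : smfun) (v : 'rV[R]_n -> R) :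
    (forall y (Uy : U y), sev Uy u = v y) ->
  sev Ux (lap D shalf A Ai u) = local_laplacian G v x.
Proof.
move=> uv; rewrite sev_sum; apply: eq_bigr => i _; rewrite sev_sum.
by apply: eq_bigr => j _; rewrite sevM AiG (sev_hess _ _ _ uv).
Qed.

Definition local_dot (u v : 'rV[R]_n -> R) (x : 'rV[R]_n) :=
  \sum_i partial i u x * \sum_j invmx (G x) i j * partial j v x.

Lemma sev_dot x (Ux : U x) (u v : smfun) (a b : 'rV[R]_n -> R) :
    (forall y (Uy : U y), sev Uy u = a y) ->
    (forall y (Uy : U y), sev Uy v = b y) ->
  sev Ux (dot D Ai u v) = local_dot a b x.
Proof.
move=> ua vb; rewrite sev_sum; apply: eq_bigr => i _.
rewrite sevM (sev_der_eq _ _ ua) sev_sum; congr (_ * _); apply: eq_bigr => j _.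
by rewrite sevM AiG (sev_der_eq _ _ vb).
Qed.

End LocalMetric.

(** * Two conformal metrics on an open set, with e^(t omega) as ring elements *)

Section ConformalPair.
Context (R : realType) (n : nat) (U : set 'rV[R]_n) (Uo : open U).
Context (om : 'rV[R]_n -> R).
Hypothesis om_smooth : smooth_on U om.
Local Notation smfun := (smfun Uo).
Local Notation D := (sder Uo).

Let som : smfun := mk_smfun Uo om_smooth.

(** The exponent is real because k/2 - l is not an integer when k is odd. *)
Definition sexp (t : R) : smfun := mk_smfun Uo
  (smooth_on_expR Uo (smooth_onM Uo (@smooth_on_cst R n U t) om_smooth)).

Lemma sev_exp x (Ux : U x) t : sev Ux (sexp t) = expR (t * om x).
Proof. exact: sev_mk. Qed.

Lemma sexpD a b : sexp a * sexp b = sexp (a + b).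
Proof. by apply: sev_inj => x Ux; rewrite sevM !sev_exp -expRD -mulrDl. Qed.

Lemma sexp0 : sexp 0 = 1.
Proof. by apply: sev_inj => x Ux; rewrite sev_exp sev1 mul0r expR0. Qed.

Lemma der_sexp i t : D i (sexp t) = scst Uo t * sexp t * D i som.
Proof.
apply: sev_inj => x Ux.
have e1 : sev Ux (D i som) = partial i om x by exact: sev_der_mk.
have e2 : sev Ux (D i (sexp t)) = partial i (expR \o (t \*o om)) x.
  by apply: sev_der_eq => y Uy; exact: sev_exp.
have dom : differentiable om x by exact: smooth_on_diff om_smooth Ux.
rewrite sevM sevM sev_cst sev_exp e1 e2.
rewrite partial_comp1; [|exact: derivable_expR|exact: differentiableZ].
rewrite derive_val /= [t * expR _]mulrC -mulrA; congr (_ * _).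
by rewrite /partial deriveZ //; exact: diff_derivable.
Qed.

Context (G Gh : 'rV[R]_n -> 'M[R]_n).
Hypothesis G_sym : forall x, U x -> (G x)^T = G x.
Hypothesis G_unit : forall x, U x -> G x \in unitmx.
Hypothesis GhE : forall x, U x -> Gh x = expR (2 * om x) *: G x.

Context (mG mGi mGh mGhi : 'M[smfun]_n).
Hypotheses (AG : represents mG G) (AiG : represents mGi (fun x => invmx (G x))).
Hypotheses (AGh : represents mGh Gh) (AiGh : represents mGhi (fun x => invmx (Gh x))).
Hypothesis mGV : mG *m mGi = 1%:M.
Local Notation s := (sexp (-1)).
Local Notation E := (sexp 2).
Local Notation half := (shalf Uo).

Let mGsym := represents_sym AG G_sym.

Let mGhE : mGh = E *: mG.
Proof.
apply/matrixP => i j; apply: sev_inj => x Ux.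
have -> : (E *: mG) i j = E * mG i j by rewrite mxE.
by rewrite sevM sev_exp AGh AG GhE // mxE.
Qed.

Let mGhiE : mGhi = s ^+ 2 *: mGi.
Proof.
apply/matrixP => i j; apply: sev_inj => x Ux.
have -> : (s ^+ 2 *: mGi) i j = s ^+ 2 * mGi i j by rewrite mxE.
rewrite sevM sevX sev_exp AiG AiGh GhE //.
rewrite invmxZ; last first.
  by rewrite unitmxZ ?unitfE ?gt_eqF ?expR_gt0 // G_unit.
by rewrite mxE -expRN expr2 -expRD; congr (expR _ * _); ring.
Qed.

Let sE : E * s ^+ 2 = 1.
Proof. by rewrite expr2 !sexpD -sexp0; congr sexp; ring. Qed.

Let Ds i : D i s = - s * D i som.
Proof.
rewrite der_sexp; apply: sev_inj => x Ux.
by rewrite (sevM Ux (_ * s)) sevM sev_cst mulN1r -sevN -sevM.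
Qed.

Let DE i : D i E = (D i som + D i som) * E.
Proof.
rewrite der_sexp; apply: sev_inj => x Ux.
by rewrite !sevM sevD sev_cst; ring.
Qed.

Let sexpE t x (Ux : U x) : sev Ux (sexp t) = (fun x => expR (t * om x)) x.
Proof. exact: sev_exp. Qed.

Lemma christoffel_conformal m i j x : U x ->
  christoffel Gh m i j x = christoffel G m i j x
    + (m == i)%:R * partial j om x + (m == j)%:R * partial i om x
    - G x i j * \sum_l invmx (G x) m l * partial l om x.
Proof.
move=> Ux; have e1 l : sev Ux (D l som) = partial l om x by exact: sev_der_mk.
rewrite -(sev_chr AGh AiGh Ux) mGhE mGhiE.
rewrite (chr_conformal (sder_commuting Uo) (shalfE Uo) mGsym mGV sE DE).
rewrite sevD (sev_chr AG AiG) -!addrA; congr (_ + _).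
rewrite sevD sevN sevD !sevM !sev_nat !e1 AG sev_sum -!addrA; congr (_ + (_ - _ * _)).
by apply: eq_bigr => l _; rewrite sevM AiG e1.
Qed.

Lemma local_einstein_hess (lam lamh : R) : (2 < n)%N ->
    (forall x, U x -> forall i j, ricci G i j x = lam * (n%:R - 1) * G x i j) ->
    (forall x, U x -> forall i j, ricci Gh i j x = lamh * (n%:R - 1) * Gh x i j) ->
  let sg x := expR (-1 * om x) in
  forall x, U x -> forall i j, 2 * sg x * local_hess G sg i j x =
    (local_dot G sg sg x - lam * sg x ^+ 2 + lamh) * G x i j.
Proof.
move=> n2 hG hGh sg x Ux i j.
(* n - m is a nonzero constant for m < n. It is cancelled for m = 1 and for m = 2, the latter by n
   >= 3. *)
have reg (m : nat) : (m < n)%N -> forall a : smfun, (n%:R - m%:R) * a = 0 -> a = 0.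
  move=> mn a /(congr1 (sev _)) e; apply: sev_inj => y Uy.
  move: {e} (e _ Uy); rewrite sevM sevD sevN !sev_nat !sev0 => /eqP.
  rewrite mulf_eq0 subr_eq0 => /orP[/eqP/eqP|/eqP//].
  by rewrite eqr_nat gtn_eqF.
have eG i0 j0 : ric D (chr D half mG mGi) i0 j0 =
    scst Uo lam * (n%:R - 1) * mG i0 j0.
  apply: sev_inj => y Uy; rewrite (sev_ric AG AiG) hG // !sevM sev_cst sevD sevN sev_nat sev1.
  by rewrite AG.
have eGh i0 j0 : ric D (chr D half (E *: mG) (s ^+ 2 *: mGi)) i0 j0 =
    scst Uo lamh * (n%:R - 1) * (E *: mG) i0 j0.
  rewrite -mGhE -mGhiE.
  apply: sev_inj => y Uy; rewrite (sev_ric AGh AiGh) hGh // !sevM sev_cst sevD sevN sev_nat sev1.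
  by rewrite AGh.
have := einstein_hess (sder_commuting Uo) (shalfE Uo) mGsym mGV
  (reg 1%N (ltnW n2)) (reg 2 n2) sE Ds DE eG eGh i j.
move=> /(congr1 (sev Ux)).
rewrite !sevM sev_nat (sev_hess AG AiG _ _ _ (sexpE (-1))) AG sevD sevD sevN sevM sevX.
by rewrite !sev_cst (sev_dot AiG _ (sexpE (-1)) (sexpE (-1))) sev_exp.
Qed.

(** Only the Hessian equation for s is assumed, not the Einstein equations, so the lemma applies in
    charts of the submanifold, with its dimension in place of n. *)
Lemma local_op_prod_conformal (lam lamh : R) :
  let sg x := expR (-1 * om x) in
  (forall x, U x -> forall i j, 2 * sg x * local_hess G sg i j x =
    (local_dot G sg sg x - lam * sg x ^+ 2 + lamh) * G x i j) ->
  forall l (u : smfun),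
  op_prod D half mGh mGhi (scst Uo lamh) (scst Uo (n%:R / 2)) l u =
  sexp (- (n%:R / 2) - l%:R) *
  op_prod D half mG mGi (scst Uo lam) (scst Uo (n%:R / 2)) l
    (sexp (n%:R / 2 - l%:R) * u).
Proof.
move=> sg hsg l u; rewrite mGhE mGhiE.
(* The equation determines 2 s f; [half * sexp 1] is the inverse of 2 s. *)
pose f := half * sexp 1 * (dot D mGi s s - scst Uo lam * s ^+ 2 + scst Uo lamh).
have half2 : 2 * half = 1 by rewrite mulr_natl mulr2n shalfE.
have s1 : s * sexp 1 = 1 by rewrite sexpD addNr sexp0.
have fE : 2 * s * f = dot D mGi s s - scst Uo lam * s ^+ 2 + scst Uo lamh.
  rewrite /f; set X := _ - _ + _.
  transitivity ((2 * half) * (s * sexp 1) * X); first by ring.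
  by rewrite half2 s1 !mul1r.
have hess_s i j : hess D half mG mGi s i j = f * mG i j.
  have e2 : 2 * s * hess D half mG mGi s i j = 2 * s * f * mG i j.
    rewrite fE; apply: sev_inj => x Ux.
    rewrite !sevM sev_nat (sev_hess AG AiG _ _ _ (sexpE (-1))) AG sevD sevD sevN sevM sevX.
    by rewrite !sev_cst (sev_dot AiG _ (sexpE (-1)) (sexpE (-1))) sev_exp hsg.
  transitivity (half * sexp 1 * (2 * s * hess D half mG mGi s i j)).
    set X := hess _ _ _ _ _ _ _.
    transitivity ((2 * half) * (s * sexp 1) * X); last by ring.
    by rewrite half2 s1 !mul1r.
  rewrite e2; transitivity ((2 * half) * (s * sexp 1) * (f * mG i j)); first by ring.
  by rewrite half2 s1 !mul1r.
apply: (op_prod_conformal (sder_commuting Uo) (shalfE Uo) mGsym mGV (om := som)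
  (a := fun l => sexp (- (n%:R / 2) - l%:R)) (b := fun l => sexp (n%:R / 2 - l%:R))
  (sder_cst Uo ^~ lam) (sder_cst Uo ^~ lamh) _ (sder_cst Uo ^~ (n%:R / 2))
  sE Ds DE hess_s fE).
- apply: sev_inj => x Ux; rewrite sevD !sev_cst sev_nat; exact: esym (splitr _).
- by rewrite sexpD -sexp0; congr sexp; ring.
- by move=> m; rewrite sexpD -natr1; congr sexp; ring.
- by move=> m; rewrite sexpD -natr1; congr sexp; ring.
move=> m i; rewrite der_sexp; congr (_ * _ * _).
by apply: sev_inj => x Ux; rewrite sevD sevN sev_nat !sev_cst.
Qed.

End ConformalPair.

(** * Immersions *)

(** The Christoffel symbols of the first kind of an induced metric, as an
    identity between the values at one point: [J] is the Jacobian, [F2] the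
    second derivatives and [dG] the derivatives of the ambient metric. *)
Lemma gauss_first_kind (R : realFieldType) (k n : nat) (G : 'M[R]_n)
    (dG : 'I_n -> 'I_n -> 'I_n -> R) (J : 'M[R]_(k, n))
    (F2 : 'I_k -> 'I_k -> 'I_n -> R) (dH : 'I_k -> 'I_k -> 'I_k -> R) :
    (forall i j, G i j = G j i) -> (forall l i j, dG l i j = dG l j i) ->
    (forall a b i, F2 a b i = F2 b a i) ->
    (forall c a b, dH c a b = \sum_i \sum_j (F2 c a i * G i j * J b j
       + J a i * (\sum_l dG l i j * J c l) * J b j + J a i * G i j * F2 c b j)) ->
  forall a b c, 2^-1 * (dH a b c + dH b a c - dH c a b) =
    \sum_p (\sum_i F2 a b i * G i p + \sum_j \sum_l 2^-1 *
      (dG j l p + dG l j p - dG p j l) * J a j * J b l) * J c p.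
Proof.
move=> Gs dGs F2s dHE a b c.
(* [B] is the metric as a bilinear form; [T x y z] is the derivative of the metric in the direction
   x, evaluated on y and z. *)
pose B x y := \sum_i \sum_j x i * G i j * y j : R.
pose T x y z := \sum_j \sum_l \sum_p dG j l p * x j * y l * z p : R.
have Bs x y : B x y = B y x.
  rewrite /B exchange_big; apply: eq_bigr => j _; apply: eq_bigr => i _ /=.
  by rewrite [G j i]Gs; ring.
have Ts x y z : T x y z = T x z y.
  rewrite /T; apply: eq_bigr => j _; rewrite exchange_big.
  by apply: eq_bigr => p _; apply: eq_bigr => l _ /=; rewrite [dG j p l]dGs; ring.
have dHE' c' a' b' : dH c' a' b' = B (F2 c' a') (J b') + T (J c') (J a') (J b')
    + B (J a') (F2 c' b').
  rewrite dHE; have -> : T (J c') (J a') (J b') =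
      \sum_i \sum_j J a' i * (\sum_l dG l i j * J c' l) * J b' j.
    rewrite /T exchange_big; apply: eq_bigr => i _ /=.
    rewrite exchange_big; apply: eq_bigr => j _ /=.
    rewrite mulr_sumr mulr_suml; apply: eq_bigr => l _; ring.
  rewrite /B -!big_split; apply: eq_bigr => i _ /=.
  by rewrite -!big_split; apply: eq_bigr => j _.
have BF a' b' x : B (F2 a' b') x = B (F2 b' a') x.
  by apply: eq_bigr => i _; apply: eq_bigr => j _; rewrite F2s.
have -> : \sum_p (\sum_i F2 a b i * G i p + \sum_j \sum_l 2^-1 *
      (dG j l p + dG l j p - dG p j l) * J a j * J b l) * J c p =
    B (F2 a b) (J c) + 2^-1 * (T (J a) (J b) (J c) + T (J b) (J a) (J c)
                               - T (J c) (J a) (J b)).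
  have -> : B (F2 a b) (J c) = \sum_p (\sum_i F2 a b i * G i p) * J c p.
    rewrite /B exchange_big; apply: eq_bigr => p _ /=.
    by rewrite mulr_suml.
  have -> : T (J a) (J b) (J c) =
      \sum_p \sum_j \sum_l dG j l p * J a j * J b l * J c p.
    rewrite exchange_big; apply: eq_bigr => j _ /=.
    by rewrite exchange_big.
  have -> : T (J b) (J a) (J c) =
      \sum_p \sum_j \sum_l dG l j p * J a j * J b l * J c p.
    rewrite /T exchange_big [RHS]exchange_big; apply: eq_bigr => j _ /=.
    rewrite [RHS]exchange_big; apply: eq_bigr => l _ /=.
    by apply: eq_bigr => p _; ring.
  have -> : T (J c) (J a) (J b) =
      \sum_p \sum_j \sum_l dG p j l * J a j * J b l * J c p.
    apply: eq_bigr => p _; apply: eq_bigr => j _; apply: eq_bigr => l _; ring.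
  rewrite -!(big_split, sumrB) mulr_sumr -big_split; apply: eq_bigr => p _ /=.
  rewrite mulrDl; congr (_ + _).
  rewrite -!(big_split, sumrB) mulr_suml mulr_sumr; apply: eq_bigr => j _ /=.
  rewrite -!(big_split, sumrB) mulr_suml mulr_sumr; apply: eq_bigr => l _ /=.
  ring.
rewrite !dHE' [B (J b) (F2 a c)]Bs [B (J a) (F2 b c)]Bs [B (J a) (F2 c b)]Bs.
rewrite (BF b a) (BF a c) (BF b c); by field; rewrite ?pnatr_eq0.
Qed.

(** * The Gauss formula for an immersion in coordinates *)

Section Gauss.
Context (R : realType) (k n : nat) (U : set 'rV[R]_k) (V : set 'rV[R]_n).
Context (Uo : open U) (Vo : open V).
Context (G : 'rV[R]_n -> 'M[R]_n) (H : 'rV[R]_k -> 'M[R]_k).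
Context (F : 'rV[R]_k -> 'rV[R]_n).
Hypothesis F_smooth : vsmooth_on U F.
Hypothesis UV : forall y, U y -> V (F y).
Hypothesis G_smooth : forall i j, smooth_on V (fun x => G x i j).
Hypothesis G_sym : forall x, V x -> (G x)^T = G x.
Hypothesis HE : forall y, U y -> H y = local_induced G F y.
Hypothesis G_unit : forall x, V x -> G x \in unitmx.

Let dF a i y : U y -> differentiable (partial a (fun z => F z 0 i)) y.
Proof. by move=> Uy; exact: smooth_on_diff (smooth_on_partial a (F_smooth i)) Uy. Qed.

Lemma partial_pull (u : 'rV[R]_n -> R) a y : smooth_on V u -> U y ->
  partial a (u \o F) y = \sum_i partial i u (F y) * jac F y a i.
Proof.
move=> su Uy; rewrite partial_comp.
- by apply: eq_bigr => i _; rewrite mxE.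
- exact: smooth_on_diff su (UV Uy).
by move=> j; exact: smooth_on_diff (F_smooth j) Uy.
Qed.

Let diff_pull (u : 'rV[R]_n -> R) y : smooth_on V u -> U y ->
  differentiable (u \o F) y.
Proof.
move=> su Uy; apply: differentiable_comp; last exact: smooth_on_diff su (UV Uy).
by apply: differentiable_row => j; exact: smooth_on_diff (F_smooth j) Uy.
Qed.

Lemma partial_sum (I : Type) (r : seq I) (f : I -> 'rV[R]_k -> R) a y :
    (forall l, differentiable (f l) y) ->
  partial a (fun z => \sum_(l <- r) f l z) y = \sum_(l <- r) partial a (f l) y.
Proof.
move=> df; have dS (s : seq I) : differentiable (fun z => \sum_(l <- s) f l z) y.
  elim: s => [|l s IHs].
    rewrite (_ : (fun _ => _) = cst 0); first exact: differentiable_cst.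
    by apply/funext => z; rewrite big_nil.
  rewrite (_ : (fun _ => _) = f l \+ fun z => \sum_(l <- s) f l z).
    exact: differentiableD.
  by apply/funext => z; rewrite big_cons.
elim: r => [|l r IHr].
  rewrite big_nil (_ : (fun _ => _) = cst 0) ?partial_cst //.
  by apply/funext => z; rewrite big_nil.
rewrite big_cons (_ : (fun _ => _) = f l \+ fun z => \sum_(l <- r) f l z).
  by rewrite partialD // IHr.
by apply/funext => z; rewrite big_cons.
Qed.

Lemma partial2_pull (u : 'rV[R]_n -> R) a b y : smooth_on V u -> U y ->
  partial a (partial b (u \o F)) y =
  \sum_i ((\sum_j partial j (partial i u) (F y) * jac F y a j) * jac F y b i
    + partial i u (F y) * partial a (partial b (fun z => F z 0 i)) y).
Proof.
move=> su Uy.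
rewrite (@partial_congr _ _ U _
  (fun z => \sum_i (partial i u \o F) z * partial b (fun z => F z 0 i) z)) ?inE //.
  have dp i : differentiable (partial i u \o F) y.
    by apply: diff_pull => //; exact: smooth_on_partial.
  rewrite partial_sum => [|i]; last by apply: differentiableM => //; exact: dF.
  apply: eq_bigr => i _; rewrite partialM //; last exact: dF.
  congr (_ * _ + _); last by rewrite mxE.
  by apply: partial_pull => //; exact: smooth_on_partial.
move=> z; rewrite inE => Uz; rewrite partial_pull //.
by apply: eq_bigr => i _; rewrite mxE.
Qed.

Lemma partial_induced a b c y : U y ->
  let F2 a b i := partial a (partial b (fun z => F z 0 i)) y in
  partial c (fun z => H z a b) y =
  \sum_i \sum_j (F2 c a i * G (F y) i j * jac F y b j
    + jac F y a i * (\sum_l partial l (fun x => G x i j) (F y) * jac F y c l)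
      * jac F y b j
    + jac F y a i * G (F y) i j * F2 c b j).
Proof.
move=> Uy F2.
pose f i j := (partial a (fun z => F z 0 i) \* ((fun x => G x i j) \o F))
  \* partial b (fun z => F z 0 j).
have dG i j : differentiable ((fun x => G x i j) \o F) y by exact: diff_pull.
have df1 i j : differentiable (partial a (fun z => F z 0 i) \* ((fun x => G x i j) \o F)) y.
  by apply: differentiableM => //; exact: dF.
have df i j : differentiable (f i j) y by apply: differentiableM => //; exact: dF.
rewrite (@partial_congr _ _ U _ (fun z => \sum_i \sum_j f i j z)) ?inE //.
  rewrite partial_sum => [|i].
    apply: eq_bigr => i _; rewrite partial_sum //; apply: eq_bigr => j _.
    have e1 := partialM c (df1 i j) (dF b j Uy).
    have e2 := partialM c (dF a i Uy) (dG i j).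
    have e3 := partial_pull c (G_smooth i j) Uy.
    have Jm d q : jac F y d q = partial d (fun z => F z 0 q) y by rewrite mxE.
    rewrite (Jm a i) (Jm b j); apply: etrans e1 _.
    by rewrite e2 e3 mulrDl.
  have -> : (fun z => \sum_j f i j z) = \sum_j f i j.
    by apply/funext => z; rewrite fct_sumE.
  exact: differentiable_sum.
move=> z; rewrite inE => Uz; rewrite HE // /local_induced mxE exchange_big.
apply: eq_bigr => j _; rewrite !mxE mulr_suml; apply: eq_bigr => i _.
by rewrite !mxE.
Qed.

Let H_sym y : U y -> (H y)^T = H y.
Proof.
move=> Uy; rewrite HE // /local_induced !trmx_mul trmxK mulmxA.
by rewrite G_sym //; exact: UV.
Qed.

(** The tangential half of the Gauss formula. [gauss_first_kind] gives it with indices lowered, once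
    [chE] has cancelled the ambient metric against its inverse; the inverse of [H] then raises the
    index. *)
Lemma christoffel_induced m a b y : U y -> christoffel H m a b y =
  (ambient_nabla G F a b y *m G (F y) *m (jac F y)^T *m invmx (H y)) 0 m.
Proof.
move=> Uy; have Vy := UV Uy.
have Gs i j : G (F y) i j = G (F y) j i by rewrite -{1}(G_sym Vy) mxE.
have iHs : (invmx (H y))^T = invmx (H y) by rewrite trmx_inv H_sym.
pose dG l i j := partial l (fun x => G x i j) (F y).
have dGs l i j : dG l i j = dG l j i.
  apply: (partial_congr _ Vo); last by rewrite inE.
  by move=> x; rewrite inE => Vx; rewrite -{1}(G_sym Vx) mxE.
have F2s a' b' i : partial a' (partial b' (fun z => F z 0 i)) y =
                   partial b' (partial a' (fun z => F z 0 i)) y.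
  exact: (partialC a' b' Uo (F_smooth i) Uy).
have key := @gauss_first_kind R k n (G (F y)) dG (jac F y) _
  (fun c a b => partial c (fun z => H z a b) y) Gs dGs F2s
  (fun c a b => partial_induced a b c Uy).
rewrite /christoffel mulr_sumr mxE; apply: eq_bigr => c _.
rewrite mulrCA mulrC; congr (_ * _); last by rewrite -{1}iHs mxE.
rewrite [LHS]key mxE; apply: eq_bigr => p _; rewrite [(jac F y)^T _ _]mxE.
congr (_ * _); rewrite mxE.
have chE j l : \sum_i christoffel G i j l (F y) * G (F y) i p =
    2^-1 * (dG j l p + dG l j p - dG p j l).
  pose v := \col_q (dG j l q + dG l j q - dG q j l).
  transitivity (2^-1 * (G (F y) *m (invmx (G (F y)) *m v)) p 0).
    rewrite mxE mulr_sumr; apply: eq_bigr => i _.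
    rewrite [(_ *m v) _ _]mxE /christoffel -mulrA; congr (_ * _).
    rewrite mulrC Gs; congr (_ * _); apply: eq_bigr => q _; by rewrite mxE.
  by rewrite mulmxA mulmxV ?mul1mx ?mxE //; exact: G_unit.
transitivity (\sum_i (partial a (partial b (fun z => F z 0 i)) y * G (F y) i p
  + (\sum_j \sum_l christoffel G i j l (F y) * jac F y a j * jac F y b l)
    * G (F y) i p)); last by apply: eq_bigr => i _; rewrite mxE mulrDl.
rewrite big_split /=; congr (_ + _).
under [RHS]eq_bigr do rewrite mulr_suml.
rewrite [RHS]exchange_big; apply: eq_bigr => j _ /=.
under [RHS]eq_bigr do rewrite mulr_suml.
rewrite [RHS]exchange_big; apply: eq_bigr => l _ /=.
by rewrite -chE !mulr_suml; apply: eq_bigr => i _; ring.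
Qed.

(** The tangential part of [nabla_a d_b F] is absorbed by the Christoffel
    symbols of the induced metric. *)
Lemma local_hess_pull (u : 'rV[R]_n -> R) a b y : smooth_on V u -> U y ->
  local_hess H (u \o F) a b y =
  \sum_j \sum_l local_hess G u j l (F y) * jac F y a j * jac F y b l
  + \sum_i partial i u (F y) * second_fundamental_form G F a b y 0 i.
Proof.
move=> su Uy.
pose An := ambient_nabla G F a b y.
have tan : \sum_m christoffel H m a b y * partial m (u \o F) y =
    \sum_i partial i u (F y) *
      (An *m G (F y) *m (jac F y)^T *m invmx (H y) *m jac F y) 0 i.
  have -> : \sum_m christoffel H m a b y * partial m (u \o F) y = \sum_m \sum_i
      partial i u (F y) * ((An *m G (F y) *m (jac F y)^T *m invmx (H y)) 0 m * jac F y m i).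
    apply: eq_bigr => m _; rewrite christoffel_induced // partial_pull // mulr_sumr.
    by apply: eq_bigr => i _; rewrite mulrCA.
  rewrite exchange_big; apply: eq_bigr => i _ /=.
  by rewrite [in RHS]mxE mulr_sumr.
rewrite /local_hess tan partial2_pull //.
have -> : \sum_i partial i u (F y) * second_fundamental_form G F a b y 0 i =
    \sum_i partial i u (F y) * An 0 i - \sum_i partial i u (F y) *
      (An *m G (F y) *m (jac F y)^T *m invmx (H y) *m jac F y) 0 i.
  rewrite -sumrB; apply: eq_bigr => i _.
  have rowB (v w : 'rV[R]_n) : (v - w) 0 i = v 0 i - w 0 i by rewrite !mxE.
  by rewrite /second_fundamental_form /normal_part -HE // rowB mulrBr.
rewrite addrA; congr (_ - _).
have -> : \sum_j \sum_l local_hess G u j l (F y) * jac F y a j * jac F y b l =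
    \sum_i (\sum_j partial j (partial i u) (F y) * jac F y a j) * jac F y b i
    - \sum_i partial i u (F y) *
      (\sum_j \sum_l christoffel G i j l (F y) * jac F y a j * jac F y b l).
  have -> : \sum_i (\sum_j partial j (partial i u) (F y) * jac F y a j) * jac F y b i =
     \sum_j \sum_l partial j (partial l u) (F y) * jac F y a j * jac F y b l.
    by rewrite [RHS]exchange_big; apply: eq_bigr => i _ /=; rewrite mulr_suml.
  have -> : \sum_i partial i u (F y) *
      (\sum_j \sum_l christoffel G i j l (F y) * jac F y a j * jac F y b l) =
     \sum_j \sum_l (\sum_i christoffel G i j l (F y) * partial i u (F y))
        * jac F y a j * jac F y b l.
    under eq_bigr do rewrite mulr_sumr.
    rewrite exchange_big; apply: eq_bigr => j _ /=.
    under eq_bigr do rewrite mulr_sumr.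
    rewrite exchange_big; apply: eq_bigr => l _ /=.
    by rewrite !mulr_suml; apply: eq_bigr => i _; ring.
  rewrite -sumrB; apply: eq_bigr => j _; rewrite -sumrB; apply: eq_bigr => l _.
  by rewrite /local_hess -!mulrBl.
rewrite big_split -addrA; congr (_ + _) => /=.
rewrite -sumrN -big_split; apply: eq_bigr => i _ /=.
by rewrite /An mxE mulrDr; ring.
Qed.

End Gauss.

(** * Invariance of the Laplacian under changes of coordinates *)

Section LaplacianPull.
Context (R : realType) (n : nat) (U V : set 'rV[R]_n).
Context (Uo : open U) (Vo : open V).
Context (G H : 'rV[R]_n -> 'M[R]_n) (F : 'rV[R]_n -> 'rV[R]_n).
Hypothesis F_smooth : vsmooth_on U F.
Hypothesis UV : forall y, U y -> V (F y).
Hypothesis G_smooth : forall i j, smooth_on V (fun x => G x i j).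
Hypothesis G_sym : forall x, V x -> (G x)^T = G x.
Hypothesis HE : forall y, U y -> H y = local_induced G F y.
Hypothesis G_unit : forall x, V x -> G x \in unitmx.
Hypothesis H_unit : forall y, U y -> H y \in unitmx.

(** A coordinate change is an immersion of codimension zero: its Jacobian [J] is square, so the
    tangential projection is the identity ([MJ]). Hence the second fundamental form vanishes and
    [local_hess_pull] has no normal term. *)
Lemma local_laplacian_pull (u : 'rV[R]_n -> R) y : smooth_on V u -> U y ->
  local_laplacian H (u \o F) y = local_laplacian G u (F y).
Proof.
move=> su Uy; set J := jac F y; set g := G (F y).
have MJ : g *m J^T *m invmx (H y) *m J = 1%:M.
  apply: mulmx1C; rewrite !mulmxA.
  by rewrite [X in X *m invmx _](_ : _ = H y) ?mulmxV ?H_unit // HE.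
have iG : J^T *m invmx (H y) *m J = invmx g.
  apply: (can_inj (mulKmx (G_unit (UV Uy)))).
  by rewrite mulmxV ?G_unit //; [rewrite !mulmxA|exact: UV].
have II0 a b : second_fundamental_form G F a b y = 0.
  rewrite /second_fundamental_form /normal_part -HE // -/J -/g.
  by rewrite -!mulmxA [X in _ *m X]mulmxA [X in _ *m X]mulmxA MJ mulmx1 subrr.
transitivity (\sum_a \sum_b \sum_j \sum_l
    invmx (H y) a b * J a j * J b l * local_hess G u j l (F y)).
  apply: eq_bigr => a _; apply: eq_bigr => b _.
  have := local_hess_pull Uo Vo F_smooth UV G_smooth G_sym HE G_unit a b su Uy.
  rewrite [X in _ + X]big1 => [|i _]; last by rewrite II0 mxE mulr0.
  rewrite addr0 => e; rewrite -[X in _ * X]/(local_hess H (u \o F) a b y) e.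
  rewrite mulr_sumr; apply: eq_bigr => j _; rewrite mulr_sumr; apply: eq_bigr => l _.
  by rewrite -/J; ring.
transitivity (\sum_j \sum_l (J^T *m invmx (H y) *m J) j l * local_hess G u j l (F y)).
  under eq_bigr do rewrite exchange_big.
  rewrite exchange_big; apply: eq_bigr => j _ /=.
  under eq_bigr do rewrite exchange_big.
  rewrite exchange_big; apply: eq_bigr => l _ /=.
  rewrite mxE mulr_suml exchange_big; apply: eq_bigr => b _ /=.
  rewrite [(_ *m invmx _) _ _]mxE !mulr_suml; apply: eq_bigr => a _.
  by rewrite [J^T _ _]mxE; ring.
by rewrite iG.
Qed.

End LaplacianPull.

(** * Submanifolds minimal for two conformal metrics *)

Section MinimalPair.
Context (R : realType) (k n : nat) (U : set 'rV[R]_k) (V : set 'rV[R]_n).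
Context (Uo : open U) (Vo : open V).
Context (G Gh : 'rV[R]_n -> 'M[R]_n) (H : 'rV[R]_k -> 'M[R]_k).
Context (F : 'rV[R]_k -> 'rV[R]_n) (om : 'rV[R]_n -> R).
Hypothesis F_smooth : vsmooth_on U F.
Hypothesis UV : forall y, U y -> V (F y).
Hypothesis om_smooth : smooth_on V om.
Hypothesis G_smooth : forall i j, smooth_on V (fun x => G x i j).
Hypothesis Gh_smooth : forall i j, smooth_on V (fun x => Gh x i j).
Hypothesis G_sym : forall x, V x -> (G x)^T = G x.
Hypothesis G_unit : forall x, V x -> G x \in unitmx.
Hypothesis Gh_unit : forall x, V x -> Gh x \in unitmx.
Hypothesis GhE : forall x, V x -> Gh x = expR (2 * om x) *: G x.
Hypothesis HE : forall y, U y -> H y = local_induced G F y.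
Hypothesis H_unit : forall y, U y -> H y \in unitmx.
Hypothesis k_gt0 : (0 < k)%N.
Hypothesis minG : forall y, U y -> mean_curvature G F y = 0.
Hypothesis minGh : forall y, U y -> mean_curvature Gh F y = 0.

Definition local_grad (y : 'rV[R]_k) : 'rV[R]_n :=
  \row_i \sum_l invmx (G (F y)) i l * partial l om (F y).

Section AtPoint.
Context (y : 'rV[R]_k) (Uy : U y).
Let J := jac F y.
Let g := G (F y).
Let iH := invmx (H y).
(** The orthogonal projection onto the tangent space, acting on row vectors from the right. *)
Let P := g *m J^T *m iH *m J.
Let W := local_grad y.
Let Vy : V (F y). Proof. exact: UV. Qed.
Let gs : g^T = g. Proof. exact: G_sym. Qed.
Let HyE : H y = J *m g *m J^T. Proof. exact: HE. Qed.
Let iHs : iH^T = iH.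
Proof. by rewrite /iH HyE trmx_inv !trmx_mul trmxK gs mulmxA. Qed.

Let normalE v : normal_part G F y v = v - v *m P.
Proof. by rewrite /normal_part -HE // /P !mulmxA. Qed.

Let JP : J *m P = J.
Proof. by rewrite /P !mulmxA -HyE mulmxV ?mul1mx // H_unit. Qed.

Let induced_conf : local_induced Gh F y = expR (2 * om (F y)) *: H y.
Proof.
by rewrite /local_induced GhE // -scalemxAr -scalemxAl -HyE.
Qed.

Let inv_conf : invmx (local_induced Gh F y) = (expR (2 * om (F y)))^-1 *: iH.
Proof.
rewrite induced_conf invmxZ // unitmxZ ?H_unit // unitfE gt_eqF // expR_gt0 //.
Qed.

(** Orthogonality is conformally invariant: the factors of the metric and of the inverse induced
    metric cancel. *)
Let normal_conf v : normal_part Gh F y v = v - v *m P.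
Proof.
rewrite /normal_part inv_conf GhE //; congr (_ - _).
set e := expR _; have e0 : e != 0 by rewrite gt_eqF // expR_gt0.
transitivity ((e^-1 * e) *: (v *m P)); last by rewrite mulVf // scale1r.
by rewrite -scalerA -!(scalemxAr, scalemxAl) /P !mulmxA.
Qed.

Let w a := \sum_j J a j * partial j om (F y).

(** The difference tensor applied to d_a F and d_b F: two tangent terms and - h_ab grad omega. *)
Let nabla_conf a b : ambient_nabla Gh F a b y =
  ambient_nabla G F a b y + w b *: row a J + w a *: row b J - H y a b *: W.
Proof.
have [A [Ai [AG AiG AV]]] := represents_metric Vo G_smooth G_unit.
have [Ah [Ahi [AGh AiGh _]]] := represents_metric Vo Gh_smooth Gh_unit.
have C := christoffel_conformal om_smooth G_sym G_unit GhE AG AiG AGh AiGh AV.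
apply/rowP => i; pose c := christoffel G.
have HyabE : H y a b = \sum_j \sum_l g j l * J a j * J b l.
  rewrite HyE mxE exchange_big; apply: eq_bigr => l _ /=.
  rewrite [(J *m g) a l]mxE [J^T l b]mxE mulr_suml; apply: eq_bigr => j _.
  by rewrite [J a j * _]mulrC.
have rowE (p q r s : 'rV[R]_n) (x z t : R) :
    (p + x *: q + z *: r - t *: s) 0 i = p 0 i + x * q 0 i + z * r 0 i - t * s 0 i.
  by rewrite !mxE.
rewrite rowE ![ambient_nabla _ _ _ _ _ 0 i]mxE -!addrA; congr (_ + _).
rewrite !addrA [row a J 0 i]mxE [row b J 0 i]mxE.
have -> : w b * J a i = \sum_j \sum_l ((i == j)%:R * partial l om (F y)) * J a j * J b l.
  transitivity (\sum_j (i == j)%:R * (J a j * w b)); first by rewrite sum_kronr mulrC.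
  apply: eq_bigr => j _; rewrite mulrA mulr_sumr; apply: eq_bigr => l _; ring.
have -> : w a * J b i = \sum_j \sum_l ((i == l)%:R * partial j om (F y)) * J a j * J b l.
  rewrite mulr_suml; apply: eq_bigr => j _.
  rewrite -(sum_kronr i (fun l => J a j * partial j om (F y) * J b l)).
  by apply: eq_bigr => l _; ring.
have -> : H y a b * W 0 i = \sum_j \sum_l (g j l * W 0 i) * J a j * J b l.
  rewrite HyabE mulr_suml; apply: eq_bigr => j _; rewrite mulr_suml.
  by apply: eq_bigr => l _; ring.
rewrite -!(big_split, sumrB); apply: eq_bigr => j _ /=.
rewrite -!(big_split, sumrB); apply: eq_bigr => l _ /=.
have WE : W 0 i = \sum_l invmx (G (F y)) i l * partial l om (F y) by rewrite mxE.
rewrite (C i j l _ (UV Uy)) -WE -/J -/g; ring.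
Qed.

(** The normal projection kills the tangent terms of [nabla_conf], so the second fundamental form
    changes by - h_ab times the normal part of grad omega. Tracing, the mean curvature vectors
    differ, up to the factor e^(-2 omega), by k times that normal part. Both vanish and k > 0. *)
Lemma grad_tangent : W *m P = W.
Proof.
have e0 : (expR (2 * om (F y)))^-1 != 0 by rewrite invr_eq0 gt_eqF // expR_gt0.
have rowP0 a : row a J - row a J *m P = 0 by rewrite -row_mul JP subrr.
have sffE a b : second_fundamental_form Gh F a b y =
    second_fundamental_form G F a b y - H y a b *: (W - W *m P).
  rewrite /second_fundamental_form normal_conf normalE nabla_conf.
  set A := ambient_nabla _ _ _ _ _.
  transitivity ((A - A *m P) + w b *: (row a J - row a J *m P)
     + w a *: (row b J - row b J *m P) - H y a b *: (W - W *m P)).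
    rewrite mulmxBl !mulmxDl -!scalemxAl.
    by apply/rowP => i; rewrite !mxE; ring.
  by rewrite !rowP0 !scaler0 !addr0.
have trk : \sum_a \sum_b iH a b * H y a b = k%:R.
  have <- : \tr (1%:M : 'M[R]_k) = k%:R by rewrite mxtrace1.
  rewrite -(mulVmx (H_unit Uy)); apply: eq_bigr => a _; rewrite mxE.
  have Hs : (H y)^T = H y by rewrite HyE !trmx_mul trmxK gs mulmxA.
  by apply: eq_bigr => b _; rewrite -{1}Hs mxE.
have := minGh Uy; rewrite /mean_curvature inv_conf.
have -> : \sum_a \sum_b ((expR (2 * om (F y)))^-1 *: iH) a b *:
      second_fundamental_form Gh F a b y =
    (expR (2 * om (F y)))^-1 *: (mean_curvature G F y - k%:R *: (W - W *m P)).
  rewrite -trk scaler_suml /mean_curvature -HE // -sumrB scaler_sumr.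
  apply: eq_bigr => a _; rewrite scaler_suml -sumrB scaler_sumr.
  apply: eq_bigr => b _; rewrite sffE mxE -!scalerA -/iH; congr (_ *: _).
  by rewrite scalerBr scalerA.
rewrite minG // sub0r => /eqP; rewrite scaler_eq0 (negPf e0) /= oppr_eq0 scaler_eq0.
by rewrite pnatr_eq0 -[k == 0%N]negbK -lt0n k_gt0 /= subr_eq0 => /eqP.
Qed.

Let dom := \row_i partial i om (F y) : 'rV[R]_n.

Let domE : dom = W *m g.
Proof.
have -> : W = dom *m invmx g.
  apply/rowP => i; rewrite !mxE; apply: eq_bigr => l _; rewrite !mxE mulrC.
  by congr (_ * _); rewrite -[in RHS]gs -trmx_inv mxE.
by rewrite -mulmxA mulVmx ?mulmx1 // G_unit.
Qed.

Let gP : g *m P^T = P *m g.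
Proof. by rewrite /P !trmx_mul !trmxK iHs gs !mulmxA. Qed.

(** d omega is the metric dual of a tangent vector, and the projection [P] is self-adjoint by
    [gP]. *)
Lemma dom_normal (v : 'rV[R]_n) :
  \sum_i partial i om (F y) * normal_part G F y v 0 i = 0.
Proof.
transitivity ((dom *m (normal_part G F y v)^T) 0 0).
  rewrite mxE; apply: eq_bigr => i _; rewrite [dom 0 i]mxE.
  by rewrite [(normal_part _ _ _ _)^T _ _]mxE.
rewrite normalE domE; move: P gP grad_tangent => Q gQ WQ.
rewrite linearB /= trmx_mul mulmxBr -!mulmxA (mulmxA g Q^T) gQ.
by rewrite !mulmxA WQ subrr mxE.
Qed.

(** Since grad omega is tangent, restricting d omega to the submanifold loses none of its length. *)
Lemma dom_sqnorm : dom *m J^T *m iH *m (dom *m J^T)^T = dom *m invmx g *m dom^T.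
Proof.
rewrite trmx_mul trmxK !mulmxA; congr (_ *m _).
rewrite domE -!mulmxA; rewrite !mulmxA -[in RHS]mulmxA mulmxV; last first.
  by rewrite G_unit //; exact: UV.
by rewrite mulmx1 -[RHS]grad_tangent /P !mulmxA.
Qed.

End AtPoint.

(** The second fundamental form need not vanish; only its pairing with ds does, ds being a multiple
    of d omega. So the Hessian of s restricts as a tensor, and |ds|^2 is unchanged by
    [dom_sqnorm]. *)
Lemma induced_hess (lam lamh : R) :
  let sg x := expR (-1 * om x) in
  (forall x, V x -> forall i j, 2 * sg x * local_hess G sg i j x =
    (local_dot G sg sg x - lam * sg x ^+ 2 + lamh) * G x i j) ->
  forall y, U y -> forall a b, 2 * (sg \o F) y * local_hess H (sg \o F) a b y =
    (local_dot H (sg \o F) (sg \o F) y - lam * (sg \o F) y ^+ 2 + lamh) * H y a b.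
Proof.
move=> sg hsg y Uy a b.
have sg_smooth : smooth_on V sg.
  exact: (smooth_on_expR Vo (smooth_onM Vo (@smooth_on_cst R n V (-1)) om_smooth)).
have dsg i : partial i sg (F y) = - sg (F y) * partial i om (F y).
  have dm : differentiable om (F y) by exact: smooth_on_diff om_smooth (UV Uy).
  have dexp : derivable expR ((-1 \*o om) (F y)) 1 by exact: derivable_expR.
  have dmN : differentiable (-1 \*o om) (F y) by exact: differentiableZ.
  have := partial_comp1 i dexp dmN; rewrite derive_val => e; apply: etrans e _.
  rewrite {1}/partial deriveZ; last exact: diff_derivable.
  by rewrite scaleN1r mulrN mulNr.
pose dm := \row_i partial i om (F y) : 'rV[R]_n.
have dotE : local_dot H (sg \o F) (sg \o F) y = local_dot G sg sg (F y).
  have bil (m : nat) (A : 'M[R]_m) (v : 'rV[R]_m) (t : R) (d : 'I_m -> R) :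
      (forall i, d i = t * v 0 i) ->
      \sum_i d i * (\sum_j A i j * d j) = t ^+ 2 * (v *m A *m v^T) 0 0.
    move=> dE; rewrite -mulmxA mxE mulr_sumr; apply: eq_bigr => i _.
    rewrite [(A *m _) _ _]mxE !mulr_sumr; apply: eq_bigr => j _.
    by rewrite !dE [v^T _ _]mxE; ring.
  rewrite /local_dot (bil _ _ dm (- sg (F y))) => [|i]; last by rewrite dsg mxE.
  rewrite (bil _ _ (dm *m (jac F y)^T) (- sg (F y))) => [|c].
    by rewrite (dom_sqnorm Uy).
  rewrite (partial_pull F_smooth UV) // mxE mulr_sumr; apply: eq_bigr => i _.
  by rewrite dsg !mxE mulrA.
have II0 : \sum_i partial i sg (F y) * second_fundamental_form G F a b y 0 i = 0.
  under eq_bigr do rewrite dsg -mulrA.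
  by rewrite -mulr_sumr dom_normal ?mulr0.
rewrite (local_hess_pull Uo Vo F_smooth UV G_smooth G_sym HE G_unit a b sg_smooth Uy).
rewrite II0 addr0 dotE; set J := jac F y; set c := _ - _ + _.
have -> : H y a b = \sum_j \sum_l G (F y) j l * J a j * J b l.
  rewrite HE // /local_induced mxE exchange_big; apply: eq_bigr => l _ /=.
  rewrite [(_ *m G (F y)) a l]mxE [J^T l b]mxE mulr_suml; apply: eq_bigr => j _.
  by rewrite [J a j * _]mulrC.
rewrite !mulr_sumr; apply: eq_bigr => j _; rewrite !mulr_sumr; apply: eq_bigr => l _.
rewrite 2!mulrA [RHS]mulrA [c * _]mulrA; congr (_ * _ * _).
exact: (hsg _ (UV Uy) j l).
Qed.

End MinimalPair.

(** * Charts *)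

Lemma open_setI_preimage (T1 T2 : topologicalType) (A : set T1) (B : set T2)
    (f : T1 -> T2) :
  open A -> open B -> (forall x, A x -> {for x, continuous f}) ->
  open (A `&` f @^-1` B).
Proof.
move=> Ao Bo fc; rewrite openE => x [Ax Bx]; apply: filterI.
  exact: open_nbhs_nbhs.
by apply: (fc x Ax); exact: open_nbhs_nbhs.
Qed.

Section Congruence.
Context (R : realType) (n : nat) (U : set 'rV[R]_n) (Uo : open U).
Context (G : 'rV[R]_n -> 'M[R]_n) (u v : 'rV[R]_n -> R).
Hypothesis uv : {in U, u =1 v}.

Lemma local_hess_congr i j x : U x -> local_hess G u i j x = local_hess G v i j x.
Proof.
move=> Ux; have p1 l : {in U, partial l u =1 partial l v} by exact: partial_congr.
have p2 : partial i (partial j u) x = partial i (partial j v) x.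
  by apply: (partial_congr i Uo (p1 j)); rewrite inE.
rewrite /local_hess p2; congr (_ - _); apply: eq_bigr => m _.
by congr (_ * _); apply: p1; rewrite inE.
Qed.

Lemma local_laplacian_congr x : U x -> local_laplacian G u x = local_laplacian G v x.
Proof.
move=> Ux; apply: eq_bigr => i _; apply: eq_bigr => j _; congr (_ * _).
exact: (local_hess_congr i j Ux).
Qed.

Lemma local_dot_congr x : U x -> local_dot G u u x = local_dot G v v x.
Proof.
move=> Ux; have p1 l : partial l u x = partial l v x.
  by apply: (partial_congr l Uo uv); rewrite inE.
apply: eq_bigr => i _; rewrite p1; congr (_ * _).
by apply: eq_bigr => j _; rewrite p1.
Qed.

End Congruence.

(** * Passage between a fixed chart and functions on the manifold *)

Section Charts.
Context (R : realType) (k : nat) (S : manifold R k) (h : metric S).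
Implicit Types (c : chart R S k) (u : S -> R).

Lemma components_unit c x : atlas S c -> cod c x -> components h c x \in unitmx.
Proof. by move=> Sc cx; apply: pos_unitmx; exact: metric_pos. Qed.

(** [laplacian] uses a chart chosen separately at each point. Iterating it requires its expression
    in one fixed chart, which the invariance under the transition map provides. *)
Lemma laplacian_param u c y : smooth_fun u -> atlas S c -> cod c y ->
  laplacian h u (param c y) = local_laplacian (components h c) (u \o param c) y.
Proof.
move=> su Sc cy; set p := param c y; pose c' := chart_at p.
have Sc' : atlas S c' by exact: chart_at_atlas.
pose U := cod c `&` (param c @^-1` dom c').
have Uo : open U.
  apply: open_setI_preimage; [exact: cod_open|exact: dom_open|].
  exact: param_continuous.
have Uy : U y by split=> //; exact: dom_chart_at.
pose F := Defs.coord c' \o param c.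
have HE z : U z -> components h c z = local_induced (components h c') F z.
  move=> [cz dz]; have := metric_change h Sc Sc' (param_dom cz) dz.
  by rewrite /= (paramK cz).
have FV z : U z -> cod c' (F z) by move=> [_ dz]; exact: coord_cod.
have E : {in U, u \o param c =1 (u \o param c') \o F}.
  by move=> z; rewrite inE => -[_ dz] /=; rewrite /F /= coordK.
rewrite (local_laplacian_congr Uo _ E Uy).
rewrite (@local_laplacian_pull R k U (cod c') Uo (@cod_open _ _ _ c')
  (components h c') (components h c) F) //.
- exact: transition_smooth.
- by move=> i j; exact: metric_smooth.
- by move=> x cx; exact: Defs.metric_sym.
- by move=> x cx; exact: components_unit.
- by move=> z [cz _]; exact: components_unit.
exact: su.
Qed.

(** The last factor of the product acts first, which is the recursion of [op_prod]. *)
Lemma P2S lam l u : P2 h lam l.+1 u = P2 h lam l (Defs.factor h lam l.+1 u).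
Proof.
rewrite /P2 unlock /reducebig /index_iota !subSS !subn0.
have -> : iota 1 l.+1 = rcons (iota 1 l) l.+1 by rewrite -[l.+1 in LHS]addn1 iotaD -cats1 add1n.
by rewrite foldr_rcons /=; elim: (iota 1 l) => //= j s ->.
Qed.

Section InChart.
Context (c : chart R S k) (Sc : atlas S c).
Let Uo : open (cod c) := @cod_open _ _ _ c.
Context (A Ai : 'M[smfun Uo]_k).
Hypotheses (AG : represents A (components h c))
           (AiG : represents Ai (fun x => invmx (components h c x))).

Definition germ u (su : smooth_fun u) : smfun Uo := mk_smfun Uo (su c Sc).

Lemma sev_germ u (su : smooth_fun u) y (cy : cod c y) :
  sev cy (germ su) = u (param c y).
Proof. exact: sev_mk. Qed.

Lemma sev_lap_germ u (su : smooth_fun u) y (cy : cod c y) :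
  sev cy (lap (sder Uo) (shalf Uo) A Ai (germ su)) = laplacian h u (param c y).
Proof.
rewrite laplacian_param //.
by apply: (sev_lap AG AiG) => z cz; exact: sev_germ.
Qed.

End InChart.

(** In each chart the result agrees with an element of the ring of smooth functions, which carries
    its own smoothness. *)
Lemma smooth_factor lam j u : smooth_fun u -> smooth_fun (Defs.factor h lam j u).
Proof.
move=> su c Sc; pose Uo := @cod_open _ _ _ c.
have [A [Ai [AG AiG _]]] := represents_metric Uo
  (metric_smooth h Sc) (fun x cx => components_unit Sc cx).
pose v := - lap (sder Uo) (shalf Uo) A Ai (germ Sc su)
          + scst Uo (lam * cj R k j) * germ Sc su.
apply: smooth_on_congr (smfun_smooth v) => // y; rewrite inE => cy.
rewrite -[LHS]/(sev cy v) sevD sevN sevM sev_cst sev_germ.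
by rewrite (sev_lap_germ Sc AG AiG).
Qed.

Lemma sev_op_prod c (Sc : atlas S c) (Uo := @cod_open _ _ _ c)
    (A Ai : 'M[smfun Uo]_k) (lam : R) l u (su : smooth_fun u) y (cy : cod c y) :
  represents A (components h c) -> represents Ai (fun x => invmx (components h c x)) ->
  sev cy (op_prod (sder Uo) (shalf Uo) A Ai (scst Uo lam) (scst Uo (k%:R / 2)) l
    (germ Sc su)) = P2 h lam l u (param c y).
Proof.
move=> AG AiG; elim: l u su => [|l IHl] u su.
  by rewrite /P2 big_nil [LHS]sev_germ.
rewrite P2S -(IHl _ (smooth_factor lam l.+1 su)) [LHS]/=.
congr (sev cy (op_prod _ _ _ _ _ _ _ _)); apply: sev_inj => z cz.
rewrite sev_germ sevD sevN (sev_lap_germ Sc AG AiG) 2!sevM sev_germ sev_cst sevM.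
rewrite (sevD cz (_ + _) (- 1)) (sevD cz _ (- _)) sevD (sevN cz 1) sevN sev1.
by rewrite !sev_cst !sev_nat.
Qed.

End Charts.

Theorem theorem1p3 (R : realType) (n k : nat)
    (hn : (3 <= n)%N) (hk1 : (1 <= k)%N) (hkn : (k <= n - 1)%N)
    (M : manifold R n) (g ghat : metric M) (lam lamhat : R) (omega : M -> R)
    (homega : smooth_fun omega)
    (hconf : conformal omega g ghat)
    (hg : einstein g lam) (hghat : einstein ghat lamhat)
    (S : manifold R k) (iota : S -> M)
    (hiota : smooth_embedding iota)
    (hmin : minimal iota g) (hminhat : minimal iota ghat)
    (h hhat : metric S)
    (hh : induced_metric iota g h) (hhhat : induced_metric iota ghat hhat) :
  forall l : nat, (1 <= l)%N ->
  forall u : S -> R, smooth_fun u ->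
    P2 hhat lamhat l u
    = (multiplication (fun p => expR ((- (k%:R / 2) - l%:R) * omega (iota p)))
       \o P2 h lam l
       \o multiplication (fun p => expR ((k%:R / 2 - l%:R) * omega (iota p))))
      u.
Proof.
have [iota_cont iota_smooth _ _ _] := hiota.
have local_dom_open d c : open (local_dom iota d c).
  apply: open_setI_preimage; [exact: cod_open|exact: dom_open|].
  move=> x cx; apply: continuous_comp; first exact: param_continuous.
  exact: iota_cont.
have F_cod d c y : local_dom iota d c y -> cod c (local_map iota d c y).
  by move=> [_ dz]; exact: coord_cod.
have in_local_dom d y : cod d y -> local_dom iota d (chart_at (iota (param d y))) y.
  by move=> dy; split=> //; exact: dom_chart_at.
have omegaE d c : {in local_dom iota d c,
    (omega \o param c) \o local_map iota d c =1 (omega \o iota) \o param d}.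
  by move=> z; rewrite inE => -[_ dz] /=; rewrite /local_map /= coordK.
have om_smooth : smooth_fun (omega \o iota).
  move=> d Sd; apply: smooth_on_local => y dy.
  pose c := chart_at (iota (param d y)).
  have Mc : atlas M c by exact: chart_at_atlas.
  exists (local_dom iota d c); first by split; [|exact: in_local_dom].
  apply: smooth_on_congr (@omegaE d c) _ => //.
  by apply: smooth_on_comp (@cod_open _ _ _ c) (F_cod d c) (iota_smooth d c Sd Mc)
    (homega c Mc).
have hhatE d y : atlas S d -> cod d y -> components hhat d y =
    expR (2 * omega (iota (param d y))) *: components h d y.
  move=> Sd dy; pose c := chart_at (iota (param d y)).
  have Mc : atlas M c by exact: chart_at_atlas.
  have Ly : local_dom iota d c y by exact: in_local_dom.
  rewrite (hhhat d c Sd Mc y Ly) (hh d c Sd Mc y Ly) /local_induced.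
  rewrite (hconf c Mc _ (F_cod _ _ _ Ly)) -scalemxAr -scalemxAl.
  by have := @omegaE d c y; rewrite inE => /(_ Ly) /= ->.
(* The equation is pointwise, so an ambient chart around the image of the given point suffices.
   There the two Einstein equations give it upstairs, and minimality restricts it. *)
have hess_S d y : atlas S d -> cod d y ->
    let sg x := expR (-1 * ((omega \o iota) \o param d) x) in forall a b,
    2 * sg y * local_hess (components h d) sg a b y =
    (local_dot (components h d) sg sg y - lam * sg y ^+ 2 + lamhat)
      * components h d y a b.
  move=> Sd dy sg a b; pose c := chart_at (iota (param d y)).
  have Mc : atlas M c by exact: chart_at_atlas.
  have Ly : local_dom iota d c y by exact: in_local_dom.
  pose sM x := expR (-1 * (omega \o param c) x).
  have sE : {in local_dom iota d c, sg =1 sM \o local_map iota d c}.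
    by move=> z Lz; rewrite /sg -(omegaE d c z Lz).
  rewrite (local_hess_congr (local_dom_open d c) _ sE) //.
  rewrite (local_dot_congr (local_dom_open d c) _ sE) //.
  rewrite sE ?inE //.
  have G_smooth i j := metric_smooth g Mc i j.
  have Gh_smooth i j := metric_smooth ghat Mc i j.
  have G_unit x (cx : cod c x) := components_unit g Mc cx.
  have Gh_unit x (cx : cod c x) := components_unit ghat Mc cx.
  have G_sym x (cx : cod c x) := Defs.metric_sym g Mc cx.
  pose Vo := @cod_open _ _ _ c.
  have [A [Ai [AG AiG AV]]] := represents_metric Vo G_smooth G_unit.
  have [Ah [Ahi [AGh AiGh _]]] := represents_metric Vo Gh_smooth Gh_unit.
  apply: (@induced_hess R k n (local_dom iota d c) (cod c) (local_dom_open d c) Vo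
    (components g c) (components ghat c) (components h d) (local_map iota d c)
    (omega \o param c)) => //.
  - exact: iota_smooth.
  - exact: F_cod.
  - exact: homega.
  - exact: hconf.
  - exact: hh.
  - by move=> z [dz _]; exact: components_unit.
  - exact: hmin.
  - exact: hminhat.
  apply: (local_einstein_hess (homega c Mc) G_sym G_unit (hconf c Mc) AG AiG
    AGh AiGh AV) => //.
  - exact: hg.
  - exact: hghat.
(* Both sides at [p] become values of elements of one ring, that of the chart chosen at [p], where
   the algebraic identity applies. *)
move=> l _ u su; apply/funext => p /=.
pose d := chart_at p; have Sd : atlas S d by exact: chart_at_atlas.
have dp : dom d p by exact: dom_chart_at.
have dy : cod d (Defs.coord d p) by exact: coord_cod.
have mult_smooth t : smooth_fun (multiplication (fun p => expR (t * omega (iota p))) u).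
  move=> c Sc; pose Uo := @cod_open _ _ _ c.
  apply: (smooth_onM Uo _ (su c Sc)); apply: smooth_on_expR => //.
  exact: (smooth_onM Uo (@smooth_on_cst R k (cod c) t) (om_smooth c Sc)).
pose Uo := @cod_open _ _ _ d.
have [A [Ai [AG AiG AV]]] := represents_metric Uo
  (metric_smooth h Sd) (fun x cx => components_unit h Sd cx).
have [Ah [Ahi [AGh AiGh _]]] := represents_metric Uo
  (metric_smooth hhat Sd)
  (fun x cx => components_unit hhat Sd cx).
rewrite /multiplication /= -[in LHS](coordK dp) -[in X in _ = _ * X](coordK dp).
rewrite -(sev_op_prod Sd lamhat l su dy AGh AiGh).
rewrite -(sev_op_prod Sd lam l (mult_smooth _) dy AG AiG).
rewrite (local_op_prod_conformal (om_smooth d Sd) (fun x cx => Defs.metric_sym h Sd cx)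
  (fun x cx => components_unit h Sd cx) (fun x cx => hhatE d x Sd cx)
  AG AiG AGh AiGh AV (fun x cx => hess_S d x Sd cx)).
rewrite sevM sev_exp /= coordK //; congr (_ * sev dy (op_prod _ _ _ _ _ _ _ _)).
apply: sev_inj => x Ux; rewrite sevM sev_exp.
by rewrite (sev_germ Sd su) (sev_germ Sd (mult_smooth _)).
Qed.
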